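(* Let $H$ be a compact Hopf algebra and let $A\subset H$ be a normal Hopf $*$-subalgebra. Assume that: (1) $A$ is inner unitary and commutative; (2) $H$ is finitely generated as a right $A$-module. Then $H$ is inner unitary.
   Context: All Hopf algebras are over $\mathbb{C}$. A Hopf $*$-algebra is a Hopf algebra that is a $*$-algebra such that $\Delta$ is a $*$-homomorphism. A Hopf ideal is a two-sided ideal $I$ with $\Delta(I)\subset I\otimes H+H\otimes I$, $\varepsilon(I)=0$, $S(I)\subset I$; a Hopf $*$-ideal is a Hopf ideal stable under $*$. A Hopf $*$-subalgebra is a Hopf subalgebra stable under $*$. A compact Hopf algebra is a Hopf $*$-algebra arising from a compact quantum group, i.e. spanned by the coefficients of its finite-dimensional unitary corepresentations. A Hopf $*$-algebra $H$ is inner unitary if there exists a $*$-representation (i.e. $*$-algebra homomorphism) $\pi:H\to B$ into a finite-dimensional $C^*$-algebra $B$ such that $\mathrm{Ker}(\pi)$ does not contain any non-zero Hopf $*$-ideal. A Hopf subalgebra $A\subset H$ is normal if it is stable under the left and right adjoint actions $\mathrm{ad}_l(x)(y)=x_{(1)}yS(x_{(2)})$ and $\mathrm{ad}_r(x)(y)=S(x_{(1)})yx_{(2)}$, $x,y\in H$ (Sweedler notation). *)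

(* Defs.v *)
From HB Require Import structures.
From mathcomp Require Import all_boot all_order all_algebra all_field.
From mathcomp Require Import boolp classical_sets reals.
From mathcomp Require Import complex.

Set Implicit Arguments.
Unset Strict Implicit.
Unset Printing Implicit Defensive.

Import Order.TTheory GRing.Theory Num.Theory.
Local Open Scope quotient_scope.
Local Open Scope ring_scope.
Local Open Scope complex_scope.

(** * Tensor product of two modules over a commutative ring

    [tensor U V] is the set of finite formal sums of pairs, i.e. lists
    [(x_1, y_1), ..., (x_n, y_n)], two such lists being identified when
    [\sum_i B x_i y_i] agrees for all balanced maps [B] into abelian groups.
    [tlift B t] is [\sum_i B x_i y_i] for a representative of [t]; it is only
    meaningful when [B] is balanced (see [tlift_tens] and [tliftD]). *)

Section Tensor.
Variables (K : comNzRingType) (U V : lmodType K).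

Definition balanced (G : zmodType) (B : U -> V -> G) : Prop :=
  [/\ forall x x' y, B (x + x') y = B x y + B x' y,
      forall x y y', B x (y + y') = B x y + B x y'
    & forall a x y, B (a *: x) y = B x (a *: y)].

Definition fsum (G : zmodType) (B : U -> V -> G) (s : seq (U * V)) : G :=
  \sum_(p <- s) B p.1 p.2.

Definition tens_eq (s t : seq (U * V)) : bool :=
  `[< forall (G : zmodType) (B : U -> V -> G),
        balanced B -> fsum B s = fsum B t >].

Lemma tens_eq_refl : reflexive tens_eq.
Proof. by move=> s; apply/asboolP. Qed.

Lemma tens_eq_sym : symmetric tens_eq.
Proof.
by move=> s t; apply/asboolP/asboolP => h G B bB; rewrite h.
Qed.

Lemma tens_eq_trans : transitive tens_eq.
Proof.
move=> t s u /asboolP st /asboolP tu; apply/asboolP => G B bB.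
by rewrite st // tu.
Qed.

Canonical tens_equiv :=
  EquivRel tens_eq tens_eq_refl tens_eq_sym tens_eq_trans.

Definition tensor : Type := {eq_quot tens_equiv}.
HB.instance Definition _ := Choice.on tensor.

Definition tclass (s : seq (U * V)) : tensor :=
  \pi_{eq_quot tens_equiv} s.
Definition trepr (t : tensor) : seq (U * V) :=
  repr (t : {eq_quot tens_equiv}).

Definition tens (x : U) (y : V) : tensor := tclass [:: (x, y)].

Definition tlift (G : zmodType) (B : U -> V -> G) (t : tensor) : G :=
  fsum B (trepr t).

Lemma treprK t : tclass (trepr t) = t.
Proof. exact: reprK. Qed.

Lemma tclassP s t : tclass s = tclass t <->
  forall (G : zmodType) (B : U -> V -> G), balanced B -> fsum B s = fsum B t.
Proof.
split=> [h|h]; last by apply/(@eqmodP _ tens_equiv)/asboolP.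
by apply/asboolP; apply/(@eqmodP _ tens_equiv).
Qed.

Lemma tlift_class (G : zmodType) (B : U -> V -> G) s :
  balanced B -> tlift B (tclass s) = fsum B s.
Proof. by move=> bB; apply: (tclassP _ _).1 => //; rewrite treprK. Qed.

Lemma fsum_cat (G : zmodType) (B : U -> V -> G) s t :
  fsum B (s ++ t) = fsum B s + fsum B t.
Proof. exact: big_cat. Qed.

Lemma balanced0l (G : zmodType) (B : U -> V -> G) y : balanced B -> B 0 y = 0.
Proof. by case=> h _ _; apply: (addrI (B 0 y)); rewrite -h !addr0. Qed.

Lemma balancedNl (G : zmodType) (B : U -> V -> G) x y :
  balanced B -> B (- x) y = - B x y.
Proof.
move=> bB; apply: (addrI (B x y)); rewrite -(let: And3 h _ _ := bB in h) !subrr.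
exact: balanced0l.
Qed.

Definition tadd (s t : tensor) : tensor := tclass (trepr s ++ trepr t).
Definition topp (t : tensor) : tensor :=
  tclass [seq (- p.1, p.2) | p <- trepr t].

Lemma tens_ext (s t : tensor) :
  (forall (G : zmodType) (B : U -> V -> G), balanced B ->
     tlift B s = tlift B t) -> s = t.
Proof. by move=> h; rewrite -(treprK s) -(treprK t); apply/tclassP. Qed.

Lemma tliftD_subproof (G : zmodType) (B : U -> V -> G) s t :
  balanced B -> tlift B (tadd s t) = tlift B s + tlift B t.
Proof. by move=> bB; rewrite tlift_class // fsum_cat. Qed.

Lemma tliftN_subproof (G : zmodType) (B : U -> V -> G) t :
  balanced B -> tlift B (topp t) = - tlift B t.
Proof.
move=> bB; rewrite tlift_class // /fsum big_map /= -sumrN.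
by apply: eq_bigr => p _; rewrite balancedNl.
Qed.

Lemma tlift0_subproof (G : zmodType) (B : U -> V -> G) :
  balanced B -> tlift B (tclass [::]) = 0.
Proof. by move=> bB; rewrite tlift_class // /fsum big_nil. Qed.

Fact taddA : associative tadd.
Proof. by move=> s t u; apply: tens_ext => G B bB; rewrite !tliftD_subproof // addrA. Qed.
Fact taddC : commutative tadd.
Proof. by move=> s t; apply: tens_ext => G B bB; rewrite !tliftD_subproof // addrC. Qed.
Fact tadd0 : left_id (tclass [::]) tadd.
Proof.
by move=> s; apply: tens_ext => G B bB; rewrite tliftD_subproof // tlift0_subproof // add0r.
Qed.
Fact taddN : left_inverse (tclass [::]) topp tadd.
Proof.
move=> s; apply: tens_ext => G B bB.
by rewrite tliftD_subproof // tliftN_subproof // tlift0_subproof // addNr.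
Qed.

HB.instance Definition _ := GRing.isZmodule.Build tensor taddA taddC tadd0 taddN.

Lemma tliftD (G : zmodType) (B : U -> V -> G) s t :
  balanced B -> tlift B (s + t) = tlift B s + tlift B t.
Proof. exact: tliftD_subproof. Qed.

Lemma tlift0 (G : zmodType) (B : U -> V -> G) : balanced B -> tlift B 0 = 0.
Proof. exact: tlift0_subproof. Qed.

Lemma tlift_tens (G : zmodType) (B : U -> V -> G) x y :
  balanced B -> tlift B (tens x y) = B x y.
Proof. by move=> bB; rewrite tlift_class // /fsum big_seq1. Qed.

Lemma tlift_sum (G : zmodType) (B : U -> V -> G) I (r : seq I)
    (P : pred I) (F : I -> tensor) : balanced B ->
  tlift B (\sum_(i <- r | P i) F i) = \sum_(i <- r | P i) tlift B (F i).
Proof.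
move=> bB; apply: (big_morph (tlift B)); first by move=> s t; exact: tliftD.
exact: tlift0.
Qed.

Lemma tens_balanced : balanced tens.
Proof.
split=> [x x' y|x y y'|a x y]; apply: tens_ext => G B bB;
  rewrite ?tliftD // !tlift_tens //; case: bB => h1 h2 h3;
  by rewrite ?h1 ?h2 ?h3.
Qed.

Lemma tensE t : t = \sum_(p <- trepr t) tens p.1 p.2.
Proof.
apply: tens_ext => G B bB; rewrite tlift_sum //.
by apply: eq_bigr => p _; rewrite tlift_tens.
Qed.

Lemma tensor_ind (P : tensor -> Prop) : P 0 -> (forall s t, P s -> P t -> P (s + t)) ->
  (forall x y, P (tens x y)) -> forall t, P t.
Proof. by move=> P0 PD Pt t; rewrite (tensE t); apply: big_ind. Qed.

Lemma tlift_addB (G : zmodType) (B B' B'' : U -> V -> G) t :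
  (forall x y, B x y = B' x y + B'' x y) ->
  tlift B t = tlift B' t + tlift B'' t.
Proof.
by move=> h; rewrite /tlift /fsum -big_split; apply: eq_bigr => p _; exact: h.
Qed.

Lemma eq_tlift (G : zmodType) (B B' : U -> V -> G) t :
  (forall x y, B x y = B' x y) -> tlift B t = tlift B' t.
Proof. by move=> h; apply: eq_bigr => p _; exact: h. Qed.

Definition tscale (a : K) (t : tensor) : tensor :=
  tlift (fun x y => tens (a *: x) y) t.

Lemma tensDl x x' y : tens (x + x') y = tens x y + tens x' y.
Proof. by case: tens_balanced. Qed.
Lemma tensDr x y y' : tens x (y + y') = tens x y + tens x y'.
Proof. by case: tens_balanced. Qed.
Lemma tensZC a x y : tens (a *: x) y = tens x (a *: y).
Proof. by case: tens_balanced. Qed.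

Lemma tscale_balanced a : balanced (fun x y => tens (a *: x) y).
Proof.
split=> [x x' y|x y y'|b x y]; first by rewrite scalerDr tensDl.
- by rewrite tensDr.
- by rewrite scalerA mulrC -scalerA tensZC.
Qed.

Lemma tscale_tens a x y : tscale a (tens x y) = tens (a *: x) y.
Proof. by rewrite /tscale tlift_tens //; exact: tscale_balanced. Qed.

Fact tscaleDr a : {morph tscale a : s t / s + t}.
Proof. by move=> s t; rewrite /tscale tliftD //; exact: tscale_balanced. Qed.

Fact tscale0 a : tscale a 0 = 0.
Proof. by rewrite /tscale tlift0 //; exact: tscale_balanced. Qed.

Fact tscaleA a b t : tscale a (tscale b t) = tscale (a * b) t.
Proof.
elim/tensor_ind: t => [|s t hs ht|x y]; first by rewrite !tscale0.
  by rewrite !tscaleDr hs ht.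
by rewrite !tscale_tens scalerA.
Qed.

Fact tscale1 : left_id 1 tscale.
Proof.
elim/tensor_ind=> [|s t hs ht|x y]; first by rewrite tscale0.
  by rewrite tscaleDr hs ht.
by rewrite tscale_tens scale1r.
Qed.

Fact tscaleDl t : {morph tscale^~ t : a b / a + b}.
Proof. by move=> a b; apply: tlift_addB => x y; rewrite scalerDl tensDl. Qed.

HB.instance Definition _ :=
  GRing.Zmodule_isLmodule.Build K tensor tscaleA tscale1 tscaleDr tscaleDl.

Lemma scale_tens a x y : a *: tens x y = tens (a *: x) y.
Proof. exact: tscale_tens. Qed.

(* The image of [P (x) Q] in [U (x) V], for subspaces [P] and [Q]. *)
Definition tens_sub (P : set U) (Q : set V) : set tensor :=
  [set t | exists s : seq (U * V),
     (forall p, p \in s -> P p.1 /\ Q p.2) /\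
     t = \sum_(p <- s) tens p.1 p.2].

End Tensor.

Definition tmap (K : comNzRingType) (U V U' V' : lmodType K)
    (f : U -> U') (g : V -> V') : tensor U V -> tensor U' V' :=
  tlift (fun x y => tens (f x) (g y)).

Definition tassoc (K : comNzRingType) (U V W : lmodType K) :
    tensor (tensor U V) W -> tensor U (tensor V W) :=
  tlift (fun t z => tlift (fun x y => tens x (tens y z)) t).

Lemma tmap_tens (K : comNzRingType) (U V U' V' : lmodType K)
    (f : {linear U -> U'}) (g : {linear V -> V'}) x y :
  tmap f g (tens x y) = tens (f x) (g y).
Proof.
rewrite /tmap tlift_tens //; split=> [x1 x2 y1|x1 y1 y2|a x1 y1].
- by rewrite linearD tensDl.
- by rewrite linearD tensDr.
- by rewrite !linearZ tensZC.
Qed.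

Lemma tassoc_tens (K : comNzRingType) (U V W : lmodType K)
    (x : U) (y : V) (z : W) :
  tassoc (tens (tens x y) z) = tens x (tens y z).
Proof.
have b1 (z1 : W) : balanced (fun (x : U) (y : V) => tens x (tens y z1)).
  split=> [x1 x2 y1|x1 y1 y2|a x1 y1]; rewrite ?tensDl ?tensDr //.
  by rewrite tensZC scale_tens.
rewrite /tassoc tlift_tens ?tlift_tens //.
split=> [t1 t2 z1|t1 z1 z2|a t1 z1]; first by rewrite tliftD.
  by apply: tlift_addB => x1 y1; rewrite !tensDr.
elim/tensor_ind: t1 => [|s t hs ht|x1 y1]; first by rewrite scaler0 !tlift0.
  by rewrite scalerDr !tliftD // hs ht.
by rewrite scale_tens !tlift_tens // !tensZC scale_tens tensZC.
Qed.

Section TensorAlgebra.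
Variables (K : comNzRingType) (U V : algType K).
Local Notation T := (tensor U V).

Definition tmul (s t : T) : T :=
  tlift (fun x y => tlift (fun x' y' => tens (x * x') (y * y')) t) s.

Lemma tmul_balancedr x y : balanced (fun (x' : U) (y' : V) => tens (x * x') (y * y')).
Proof.
split=> [x1 x2 y1|x1 y1 y2|a x1 y1]; rewrite ?mulrDr ?tensDl ?tensDr //.
by rewrite -!scalerAr tensZC.
Qed.

Lemma tmul_balancedl (t : T) :
  balanced (fun x y => tlift (fun x' y' => tens (x * x') (y * y')) t).
Proof.
split=> [x1 x2 y1|x1 y1 y2|a x1 y1].
- by apply: tlift_addB => x' y'; rewrite mulrDl tensDl.
- by apply: tlift_addB => x' y'; rewrite mulrDl tensDr.
- by apply: eq_tlift => x' y'; rewrite -!scalerAl tensZC.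
Qed.

Lemma tmul_tens x y x' y' : tmul (tens x y) (tens x' y') = tens (x * x') (y * y').
Proof.
by rewrite /tmul tlift_tens ?tlift_tens //;
  [exact: tmul_balancedr | exact: tmul_balancedl].
Qed.

Fact tmulDl : left_distributive tmul +%R.
Proof. by move=> s t u; rewrite /tmul tliftD //; exact: tmul_balancedl. Qed.

Fact tmulDr : right_distributive tmul +%R.
Proof.
move=> s t u; apply: tlift_addB => x y.
by rewrite tliftD //; exact: tmul_balancedr.
Qed.

Fact tmul0l t : tmul 0 t = 0.
Proof. by rewrite /tmul tlift0 //; exact: tmul_balancedl. Qed.

Fact tmul0r t : tmul t 0 = 0.
Proof. by apply: (addrI (tmul t 0)); rewrite -tmulDr !addr0. Qed.

Fact tmulA : associative tmul.
Proof.
move=> s t u; elim/tensor_ind: s => [|s s' hs hs'|x y]; first by rewrite !tmul0l.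
  by rewrite !tmulDl hs hs'.
elim/tensor_ind: t => [|s s' hs hs'|x' y']; first by rewrite !(tmul0l, tmul0r).
  by rewrite !(tmulDl, tmulDr) hs hs'.
elim/tensor_ind: u => [|s s' hs hs'|x1 y1]; first by rewrite !tmul0r.
  by rewrite !tmulDr hs hs'.
by rewrite !tmul_tens !mulrA.
Qed.

Fact tmul1l : left_id (tens 1 1) tmul.
Proof.
elim/tensor_ind=> [|s s' hs hs'|x y]; first by rewrite tmul0r.
  by rewrite tmulDr hs hs'.
by rewrite tmul_tens !mul1r.
Qed.

Fact tmul1r : right_id (tens 1 1) tmul.
Proof.
elim/tensor_ind=> [|s s' hs hs'|x y]; first by rewrite tmul0l.
  by rewrite tmulDl hs hs'.
by rewrite tmul_tens !mulr1.
Qed.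

HB.instance Definition _ :=
  GRing.Zmodule_isPzRing.Build T tmulA tmul1l tmul1r tmulDl tmulDr.

Lemma mul_tens x y x' y' : tens x y * tens x' y' = tens (x * x') (y * y') :> T.
Proof. exact: tmul_tens. Qed.

End TensorAlgebra.

Section Star.
Variable R : realType.
Local Notation C := R[i].

Definition is_star (A : algType C) (star : A -> A) : Prop :=
  [/\ involutive star,
      {morph star : x y / x + y},
      forall (a : C) x, star (a *: x) = (conjc a) *: star x
    & forall x y, star (x * y) = star y * star x].

Lemma tmap_star (A : algType C) (s : A -> A) x y :
  is_star s -> tmap s s (tens x y) = tens (s x) (s y).
Proof.
case=> _ sD sZ _; rewrite /tmap tlift_tens //.
by split=> [x1 x2 y1|x1 y1 y2|a x1 y1]; rewrite ?sD ?tensDl ?tensDr ?sZ ?tensZC.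
Qed.

Record fdCstarAlg := FdCstarAlg {
  fdc_alg :> falgType C;
  fdc_star : fdc_alg -> fdc_alg;
  fdc_norm : fdc_alg -> R;
  fdc_starP : is_star fdc_star;
  fdc_norm_ge0 : forall x, 0 <= fdc_norm x;
  fdc_norm_eq0 : forall x, fdc_norm x = 0 -> x = 0;
  fdc_normD : forall x y, fdc_norm (x + y) <= fdc_norm x + fdc_norm y;
  fdc_normZ : forall (a : C) x, fdc_norm (a *: x) = Normc.normc a * fdc_norm x;
  fdc_normM : forall x y, fdc_norm (x * y) <= fdc_norm x * fdc_norm y;
  fdc_Cstar : forall x, fdc_norm (fdc_star x * x) = fdc_norm x ^+ 2;
  fdc_complete : forall u : nat -> fdc_alg,
    (forall e : R, 0 < e -> exists N : nat, forall m n : nat,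
       (N <= m)%N -> (N <= n)%N -> fdc_norm (u m - u n) < e) ->
    exists l, forall e : R, 0 < e -> exists N : nat, forall n : nat,
       (N <= n)%N -> fdc_norm (u n - l) < e }.

(* The star operation of [H (x) H] is [tmap star star]; although [star] is
   antilinear, it is well defined on tensors (see [tmap_star]). *)
Record hopfStarAlg := HopfStarAlg {
  hopf_alg :> algType C;
  star : hopf_alg -> hopf_alg;
  comul : {linear hopf_alg -> tensor hopf_alg hopf_alg};
  counit : {lrmorphism hopf_alg -> C^o};
  antipode : {linear hopf_alg -> hopf_alg};
  starP : is_star star;
  comul_monoid_morphism : monoid_morphism comul;
  comul_star : forall x, comul (star x) = tmap star star (comul x);
  comulA : forall x, tmap id comul (comul x) = tassoc (tmap comul id (comul x));
  counitl : forall x, tlift (fun a b => counit a *: b) (comul x) = x;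
  counitr : forall x, tlift (fun a b => counit b *: a) (comul x) = x;
  antipodel : forall x,
    tlift (fun a b => antipode a * b) (comul x) = (counit x)%:A;
  antipoder : forall x,
    tlift (fun a b => a * antipode b) (comul x) = (counit x)%:A }.

Arguments star {_} _.
Arguments comul {_}.
Arguments counit {_}.
Arguments antipode {_}.

Section HopfNotions.
Variable H : hopfStarAlg.

Definition two_sided_ideal (I : set H) : Prop :=
  [/\ I 0,
      forall x y, I x -> I y -> I (x + y),
      forall h x, I x -> I (h * x)
    & forall h x, I x -> I (x * h)].

Definition hopf_star_ideal (I : set H) : Prop :=
  [/\ two_sided_ideal I,
      forall x, I x -> exists t u, [/\ tens_sub I setT t, tens_sub setT I u
                                     & comul x = t + u],
      forall x, I x -> counit x = 0,
      forall x, I x -> I (antipode x)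
    & forall x, I x -> I (star x)].

Definition inner_unitary : Prop :=
  exists (B : fdCstarAlg) (pi : {lrmorphism H -> B}),
    (forall x, pi (star x) = fdc_star (pi x)) /\
    ~ exists I : set H, [/\ hopf_star_ideal I, I <> [set 0]%classic
                          & (I `<=` [set x | pi x = 0])%classic].

Definition unitary_corep (n : nat) (u : 'M[H]_n) : Prop :=
  [/\ forall i j, comul (u i j) = \sum_k tens (u i k) (u k j),
      forall i j, counit (u i j) = (i == j)%:R,
      u *m map_mx star u^T = 1%:M
    & map_mx star u^T *m u = 1%:M].

Definition unitary_coef (x : H) : Prop :=
  exists (n : nat) (u : 'M[H]_n) (i j : 'I_n), unitary_corep u /\ x = u i j.

Definition compact_hopf : Prop :=
  forall x : H, exists s : seq (C * H),
    (forall p, p \in s -> unitary_coef p.2) /\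
    x = \sum_(p <- s) p.1 *: p.2.

Definition adl (x y : H) : H :=
  tlift (fun a b => a * y * antipode b) (comul x).

Definition adr (x y : H) : H :=
  tlift (fun a b => antipode a * y * b) (comul x).

(* A Hopf star-subalgebra is given as a Hopf star-algebra together with its
   inclusion in [H]; it is stable under the operations of [H] because the
   inclusion commutes with them. *)
Record hopfStarSubalg := HopfStarSubalg {
  sub_hopf :> hopfStarAlg;
  incl : {lrmorphism sub_hopf -> H};
  incl_inj : injective incl;
  incl_comul : forall a, comul (incl a) = tmap incl incl (comul a);
  incl_counit : forall a, counit (incl a) = counit a;
  incl_antipode : forall a, antipode (incl a) = incl (antipode a);
  incl_star : forall a, star (incl a) = incl (star a) }.

Definition normal_subalg (A : hopfStarSubalg) : Prop :=
  forall (x : H) (y : A),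
    range (incl A) (adl x (incl A y)) /\ range (incl A) (adr x (incl A y)).

Definition fg_right_module (A : hopfStarSubalg) : Prop :=
  exists (n : nat) (h : 'I_n -> H), forall x : H,
    exists a : 'I_n -> A, x = \sum_(i < n) h i * incl A (a i).

End HopfNotions.

Definition commutative_alg (A : hopfStarAlg) : Prop :=
  commutative (@GRing.mul A).

End Star.

(* Main.v *)
Require Import Defs.
From HB Require Import structures.
From mathcomp Require Import all_boot all_order all_algebra all_field.
From mathcomp Require Import boolp classical_sets reals.
From mathcomp Require Import complex spectral ring lra.

(** The representation of [A] is induced to [H] along a conditional expectation,
and the expectation also transports Hopf star-ideals from [H] back to [A].

Since [H] is spanned by coefficients of unitary corepresentations, it is
cosemisimple, so the subcoalgebra [A] has a canonical complement and there is
a bicolinear projection [E : H -> A]. Concretely, for a unitary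
corepresentation [u] let [p] be the orthogonal projection onto the space of
vectors [w] such that [u w] has entries in [A]; then [p] commutes with [u],
and [E] sends the entries of [u] to those of [u p]. That this is independent
of all choices is [matcoef_inA_null]: the part of [u] killed by [p] has no
nonzero coefficient in [A]. It follows that [E] is [A]-bilinear and commutes
with the star, the antipode and the comultiplication.

Two further properties of [E] carry the proof. First, [E (star x * x)] is a
finite sum of elements [star z * z] with [z] in [A] ([expectation_positive]).
Second, if [E (y * x) = 0] for all [y] then [x = 0]
([expectation_nondegenerate]). Writing [x] as a coefficient of [u], both
concern the coaction [T |-> adj u * T * u] of [H] on a matrix algebra, on
which [E] acts as a projection onto the subalgebra of those [T] whose image
has entries in [A]. This projection preserves a faithful positive functional,
which exists because the entries of the conjugate of [u] are again
coefficients of a unitary corepresentation ([conjugate_invariant_form]).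

Now let [pi : A -> B] be inner faithful and put
[theta a = tr (left multiplication by pi a) + counit a]. As [A] is commutative,
[theta (star a * a)] is nonnegative, and vanishes only if [pi a = 0] and
[counit a = 0]. Hence [phi = theta \o E] is positive on [H]. Its GNS space is
finite-dimensional because [H] is finitely generated over [A], so [H] acts on
it through some matrix algebra, a finite-dimensional C*-algebra for the
operator norm. If a Hopf star-ideal [I] acts by zero, then [phi] vanishes on
[I], so [theta] vanishes on [E I], which is a Hopf star-ideal of [A]: the
counit summand of [theta] is what makes the counit vanish on [E I]. Therefore
[E I] lies in the kernel of [pi], hence is zero, and nondegeneracy of [E]
gives [I = 0]. *)

Set Implicit Arguments.
Unset Strict Implicit.
Unset Printing Implicit Defensive.

Import Order.TTheory GRing.Theory Num.Theory.
Local Open Scope ring_scope.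

(** * Linear functionals and slices of tensors *)
Section Functionals.
Variables (K : fieldType) (V : lmodType K).

Definition subspace (W : set V) : Prop :=
  W 0 /\ forall a x y, W x -> W y -> W (a *: x + y).

Lemma subspaceZ W a x : subspace W -> W x -> W (a *: x).
Proof. by case=> W0 WD Wx; rewrite -[_ *: _]addr0; apply: WD. Qed.

Lemma subspaceD W x y : subspace W -> W x -> W y -> W (x + y).
Proof. by case=> _ WD Wx Wy; rewrite -[x]scale1r; apply: WD. Qed.

Lemma subspaceB W x y : subspace W -> W x -> W y -> W (x - y).
Proof. by case=> _ WD Wx Wy; rewrite addrC -scaleN1r; apply: WD. Qed.

Lemma subspace_sum W I (r : seq I) (P : pred I) F : subspace W ->
  (forall i, P i -> W (F i)) -> W (\sum_(i <- r | P i) F i).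
Proof.
by move=> sW h; apply: big_ind => //; [case: sW | move=> x y; apply: subspaceD].
Qed.

(** By Zorn's lemma there is a maximal subspace [A] containing [W] and avoiding
[x]. Every [y] is congruent modulo [A] to a unique multiple of [x], and that
multiple is the value of the functional. The empty set is included in the
ordered family so that the union of the empty chain is covered. *)
Lemma separating_functional (W : set V) (x : V) : subspace W -> ~ W x ->
  exists f : {scalar V}, (forall y, W y -> f y = 0) /\ f x = 1.
Proof.
move=> sW Wx.
pose P M := M = set0 \/ [/\ subspace M, (W `<=` M)%classic & ~ M x].
have Wne : W <> set0 by move=> W0; case: sW => + _; rewrite W0.
have [F FP Ftot|A [PA Amax]] := @Zorn_bigcup V P.
  have [[M0 FM0 M0ne]|Fe] := pselect (exists2 M, F M & M <> set0); last first.
    left; apply/seteqP; split=> // y [M FM My].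
    by apply: Fe; exists M => // M0; rewrite M0 in My.
  have prop M : F M -> M <> set0 -> [/\ subspace M, (W `<=` M)%classic & ~ M x].
    by move=> FM Mne; case: (FP _ FM).
  right; split.
  - split.
      by exists M0 => //; case: (prop _ FM0 M0ne) => -[].
    move=> a y z [M1 FM1 M1y] [M2 FM2 M2z].
    have [s12|s21] := Ftot _ _ FM1 FM2.
      exists M2 => //; case: (prop M2) => // [M20|[_ D2] _ _].
        by rewrite M20 in M2z.
      by apply: D2 => //; apply: s12.
    exists M1 => //; case: (prop M1) => // [M10|[_ D1] _ _].
      by rewrite M10 in M1y.
    by apply: D1 => //; apply: s21.
  - by move=> y Wy; exists M0 => //; case: (prop _ FM0 M0ne) => _ + _; apply.
  - move=> [M FM Mx]; case: (prop M) => // Me; by rewrite Me in Mx.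
have {PA} [sA WA Ax] : [/\ subspace A, (W `<=` A)%classic & ~ A x].
  case: PA => // A0; exfalso; apply: (Amax W); last by right; split.
  rewrite A0; split; first by move=> y [].
  by move=> WA0; apply: Wne; apply/seteqP; split.
have dec y : exists a, A (y - a *: x).
  have [Ay|Ay] := pselect (A y); first by exists 0; rewrite scale0r subr0.
  pose B := [set z | exists b, A (z - b *: y)]%classic.
  have AB : (A `<=` B)%classic by move=> z Az; exists 0; rewrite scale0r subr0.
  have By : B y by exists 1; rewrite scale1r subrr; case: sA.
  have sB : subspace B.
    split; first by apply: AB; case: sA.
    move=> a z1 z2 [b1 h1] [b2 h2]; exists (a * b1 + b2).
    have -> : a *: z1 + z2 - (a * b1 + b2) *: y
       = a *: (z1 - b1 *: y) + (z2 - b2 *: y).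
      by rewrite scalerDl -scalerA scalerBr opprD addrACA.
    by case: sA => _; apply.
  have [[b Ab]|Bx] := pselect (B x); last first.
    exfalso; apply: (Amax B); last by right; split=> // z /WA /AB.
    by split=> // BA; apply/Ay/BA.
  have bN0 : b != 0.
    by apply/eqP => b0; apply: Ax; move: Ab; rewrite b0 scale0r subr0.
  exists b^-1.
  have -> : y - b^-1 *: x = (- b^-1) *: (x - b *: y).
    by rewrite scalerBr !scaleNr opprK scalerA mulVf // scale1r addrC.
  exact: subspaceZ.
have uniq y a b : A (y - a *: x) -> A (y - b *: x) -> a = b.
  move=> ha hb; apply: contrapT => /eqP; rewrite -subr_eq0 => ab; apply: Ax.
  have := subspaceB sA hb ha.
  rewrite opprB addrC addrA subrK -scalerBl => /(subspaceZ (a - b)^-1 sA).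
  by rewrite scalerA mulVf // scale1r.
pose f y := projT1 (cid (dec y)).
have fP y : A (y - f y *: x) by rewrite /f; case: cid.
have flin : scalar f.
  move=> a y z; apply: (uniq (a *: y + z)); first exact: fP.
  have -> : a *: y + z - (a * f y + f z) *: x
       = a *: (y - f y *: x) + (z - f z *: x).
    by rewrite scalerDl -scalerA scalerBr opprD addrACA.
  by case: sA => _; apply.
pose fL := GRing.isLinear.Build K V K _ f flin.
pose f' : {scalar V} := HB.pack f fL.
exists f'; split=> [y Wy|]; apply: (uniq _ _ _ (fP _)).
  by rewrite scale0r subr0; apply: WA.
by rewrite scale1r subrr; case: sA.
Qed.

Lemma functional_ext (x y : V) : (forall f : {scalar V}, f x = f y) -> x = y.
Proof.
move=> h; apply/eqP; rewrite -subr_eq0; apply/eqP; apply: contrapT => xy.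
have [|f [_ f1]] := @separating_functional [set 0]%classic (x - y) _ xy.
  by split=> // a u v -> ->; rewrite scaler0 addr0.
by move: f1; rewrite linearB h subrr => /esym/eqP; rewrite oner_eq0.
Qed.

End Functionals.

Section TensorMaps.
Variable K : comNzRingType.

Lemma tliftZ (U V W : lmodType K) (B : U -> V -> W) a t : balanced B ->
  (forall b x y, B (b *: x) y = b *: B x y) ->
  tlift B (a *: t) = a *: tlift B t.
Proof.
move=> bB BZ; elim/tensor_ind: t => [|s t hs ht|x y].
- by rewrite scaler0 tlift0 // scaler0.
- by rewrite scalerDr !tliftD // hs ht scalerDr.
- by rewrite scale_tens !tlift_tens // BZ.
Qed.

Section Slice.
Variables (U V : lmodType K).

(** Slicing an element of [U (x) V] by functionals reduces identities between
tensors to identities between vectors. *)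
Definition slice_r (f : {scalar V}) : tensor U V -> U :=
  tlift (fun x y => f y *: x).
Definition slice_l (f : {scalar U}) : tensor U V -> V :=
  tlift (fun x y => f x *: y).

Lemma slice_r_balanced (f : {scalar V}) : balanced (fun (x : U) y => f y *: x).
Proof.
split=> [x x' y|x y y'|a x y]; rewrite ?scalerDr ?linearD ?scalerDl //.
by rewrite [f (a *: _)]linearZ scalerA mulrC.
Qed.

Lemma slice_l_balanced (f : {scalar U}) : balanced (fun x (y : V) => f x *: y).
Proof.
split=> [x x' y|x y y'|a x y]; rewrite ?scalerDr ?linearD ?scalerDl //.
by rewrite [f (a *: _)]linearZ scalerA mulrC.
Qed.

Lemma slice_r_tens f x y : slice_r f (tens x y) = f y *: x.
Proof. by rewrite /slice_r tlift_tens //; apply: slice_r_balanced. Qed.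

Lemma slice_l_tens f x y : slice_l f (tens x y) = f x *: y.
Proof. by rewrite /slice_l tlift_tens //; apply: slice_l_balanced. Qed.

Lemma slice_r_linear f : linear (slice_r f).
Proof.
move=> a s t; have b := slice_r_balanced f.
rewrite /slice_r tliftD // tliftZ // => c x y.
by rewrite !scalerA mulrC.
Qed.

Lemma slice_l_linear f : linear (slice_l f).
Proof.
move=> a s t; have b := slice_l_balanced f.
by rewrite /slice_l tliftD // tliftZ // => c x y; rewrite linearZ scalerA.
Qed.

HB.instance Definition _ f :=
  GRing.isLinear.Build K (tensor U V) U _ (slice_r f) (slice_r_linear f).
HB.instance Definition _ f :=
  GRing.isLinear.Build K (tensor U V) V _ (slice_l f) (slice_l_linear f).

End Slice.

Section TMap.
Variables (U V U' V' : lmodType K) (f : {linear U -> U'}) (g : {linear V -> V'}).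

Lemma tmap_balanced : balanced (fun x y => tens (f x) (g y)).
Proof.
split=> [x x' y|x y y'|a x y]; rewrite ?linearD ?tensDl ?tensDr //.
by rewrite !linearZ tensZC.
Qed.

Lemma tmap_linear : linear (tmap f g).
Proof.
move=> a s t; have b := tmap_balanced.
rewrite /tmap tliftD // tliftZ // => c x y.
by rewrite linearZ scale_tens.
Qed.

HB.instance Definition _ :=
  GRing.isLinear.Build K (tensor U V) (tensor U' V') _ (tmap f g) tmap_linear.
End TMap.

End TensorMaps.

(** * Positive forms and orthonormal families *)
Local Notation "M ^*t" := (map_mx Num.conj (trmx M)) (at level 8, format "M ^*t") : ring_scope.

Lemma eq_of_eq_subr (U : zmodType) (x y z t : U) : z = t -> x - y = z - t -> x = y.
Proof. by move=> ->; rewrite subrr => /eqP; rewrite subr_eq0 => /eqP. Qed.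

Section Forms.
Variables (C : numClosedFieldType) (V : lmodType C) (b : V -> V -> C).

Definition psd_form : Prop :=
  [/\ forall x a y z, b x (a *: y + z) = a * b x y + b x z,
      forall a x y z, b (a *: x + y) z = a^* * b x z + b y z
    & forall x, 0 <= b x x].

Hypothesis bP : psd_form.

Let bl x a y z : b x (a *: y + z) = a * b x y + b x z.
Proof. by case: bP. Qed.
Let bs a x y z : b (a *: x + y) z = a^* * b x z + b y z.
Proof. by case: bP. Qed.
Let bp x : 0 <= b x x. Proof. by case: bP. Qed.

Lemma psdDr x y z : b x (y + z) = b x y + b x z.
Proof. by rewrite -[y]scale1r bl mul1r scale1r. Qed.
Lemma psdDl x y z : b (x + y) z = b x z + b y z.
Proof. by rewrite -[x]scale1r bs rmorph1 mul1r scale1r. Qed.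
Lemma psd0r x : b x 0 = 0.
Proof. by apply: (addrI (b x 0)); rewrite -psdDr !addr0. Qed.
Lemma psd0l x : b 0 x = 0.
Proof. by apply: (addrI (b 0 x)); rewrite -psdDl !addr0. Qed.
Lemma psdZr x a y : b x (a *: y) = a * b x y.
Proof. by rewrite -[_ *: _]addr0 bl psd0r addr0. Qed.
Lemma psdZl x a y : b (a *: x) y = a^* * b x y.
Proof. by rewrite -[_ *: _]addr0 bs psd0l addr0. Qed.
Lemma psdBr x y z : b x (y - z) = b x y - b x z.
Proof. by rewrite psdDr -scaleN1r psdZr mulN1r. Qed.
Lemma psdBl x y z : b (x - y) z = b x z - b y z.
Proof. by rewrite psdDl -scaleN1r psdZl rmorphN1 mulN1r. Qed.
Lemma psd_sumr x I (r : seq I) (P : pred I) F :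
  b x (\sum_(i <- r | P i) F i) = \sum_(i <- r | P i) b x (F i).
Proof. by apply: (big_morph (b x) (psdDr x) (psd0r x)). Qed.
Lemma psd_suml x I (r : seq I) (P : pred I) F :
  b (\sum_(i <- r | P i) F i) x = \sum_(i <- r | P i) b (F i) x.
Proof.
by apply: (big_morph (b^~ x) (fun y z => psdDl y z x) (psd0l x)).
Qed.

(** Polarization: positivity makes [b (x + a y) (x + a y)] real for [a = 1] and
[a = 'i], which determines [b y x] from [b x y]. *)
Lemma psd_herm x y : b y x = (b x y)^*.
Proof.
have re z : (b z z)^* = b z z by apply/CrealP/ger0_real.
have h a : a^* * (b x y)^* + a * (b y x)^* = a * b x y + a^* * b y x.
  have := re (x + a *: y).
  rewrite !(psdDl, psdDr, psdZl, psdZr) !rmorphD !rmorphM /= !re conjCK.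
  by move=> e; apply: (eq_of_eq_subr e); ring.
have := h 1; have := h 'i; rewrite !conjCi rmorph1 => hi h1.
have {}hi : (b y x)^* - (b x y)^* = b x y - b y x.
  by apply: (mulfI (neq0Ci C)); apply: (eq_of_eq_subr hi); ring.
apply: (can_inj conjCK); rewrite conjCK.
have h12 := congr2 +%R h1 hi.
by apply: (@mulfI _ 2%:R); [rewrite pnatr_eq0|apply: (eq_of_eq_subr h12); ring].
Qed.

Lemma psd_CS x y : `|b x y| ^+ 2 <= b x x * b y y.
Proof.
have [xx0|xxN0] := eqVneq (b x x) 0.
  suff -> : b x y = 0 by rewrite normr0 expr0n xx0 mul0r.
  apply/eqP/negPn/negP => xyN0.
  (* subtracting this multiple of [x] from [y] gives a vector of square norm - 1 *)
  pose s := (b y y + 1) / (2 * `|b x y| ^+ 2).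
  have sr : s^* = s.
    apply/CrealP; rewrite ger0_real // divr_ge0 ?addr_ge0 ?ler01 ?bp //.
    by rewrite mulr_ge0 ?exprn_ge0 ?ler0n.
  have := bp (y - (s * b x y) *: x).
  rewrite !(psdBl, psdBr, psdZl, psdZr) xx0.
  have -> : (s * b x y)^* = s * (b x y)^* by rewrite rmorphM /= sr.
  rewrite (psd_herm x y) !mulr0 subr0.
  set t := (X in 0 <= X); suff -> : t = - 1 by rewrite oppr_ge0 ler10.
  have nn : `|b x y| ^+ 2 != 0 by rewrite expf_neq0 ?normr_eq0.
  rewrite /t /s normCK; field.
  by move: xyN0 nn; rewrite normCK mulf_eq0 negb_or => -> /andP[_ ->].
have xxgt0 : 0 < b x x by rewrite lt_def xxN0 bp.
have := bp (y - (b x y / b x x) *: x).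
have xxr : (b x x)^* = b x x by apply/CrealP/ger0_real.
have qE : (b x y / b x x)^* = (b x y)^* / b x x.
  by rewrite rmorphM fmorphV /= xxr.
rewrite !(psdBl, psdBr, psdZl, psdZr) qE.
rewrite (psd_herm x y) => h; rewrite normCK -subr_ge0.
have := mulr_ge0 (bp x) h; congr (0 <= _); field.
exact: xxN0.
Qed.

Lemma psd_null x y : b x x = 0 -> b x y = 0.
Proof.
move=> xx; have := psd_CS x y; rewrite xx mul0r => h.
by apply/eqP; rewrite -normr_eq0 -sqrf_eq0 eq_le h exprn_ge0.
Qed.

Definition orthonormal_family k (e : 'I_k -> V) := forall i j, b (e i) (e j) = (i == j)%:R.

(** An orthonormal family of maximal size in [W] spans [W] up to null vectors:
a remainder of nonzero norm could be normalized and added to the family.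
The form may be degenerate, as for the GNS construction, so the conclusion is
only that remainders have norm zero. *)
Lemma maximal_orthonormal (W : set V) M : subspace W ->
  (forall k (e : 'I_k -> V), (forall i, W (e i)) -> orthonormal_family e -> (k <= M)%N) ->
  exists k (e : 'I_k -> V), [/\ forall i, W (e i), orthonormal_family e &
    forall x, W x -> let r := x - \sum_i b (e i) x *: e i in b r r = 0].
Proof.
move=> sW bd.
pose Q k := `[< exists e : 'I_k -> V, (forall i, W (e i)) /\ orthonormal_family e >].
have exQ : exists k, Q k by exists 0; apply/asboolP; exists (fun=> 0); split=> -[].
have QM k : Q k -> (k <= M)%N by move=> /asboolP [e [? ?]]; apply: bd.
have [k /asboolP [e [We one]] kmax] := ex_maxnP exQ QM.
exists k, e; split=> // x Wx r; apply/eqP/negPn/negP => rN0.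
have rgt0 : 0 < b r r by rewrite lt_def rN0 bp.
have er i : b (e i) r = 0.
  rewrite /r psdBr psd_sumr (bigD1 i) //= psdZr one eqxx mulr1 big1 ?addr0 ?subrr //.
  by move=> j ji; rewrite psdZr one eq_sym (negPf ji) mulr0.
pose c := (sqrtC (b r r))^-1.
have cr : c^* = c by apply/CrealP; rewrite ger0_real // invr_ge0 sqrtC_ge0.
have ccr : c * (c * b r r) = 1.
  rewrite mulrA -[c * c]expr2 exprVn sqrtCK mulVf //.
have Wr : W r.
  apply: subspaceB => //; apply: subspace_sum => // i _; exact: subspaceZ.
suff /kmax : Q k.+1 by rewrite ltnn.
apply/asboolP; exists (fun i => if unlift ord_max i is Some j then e j else c *: r).
split=> [i|i j]; first by case: unliftP => [j _|_] //; apply: subspaceZ.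
case: unliftP => [i'|] ->; case: unliftP => [j'|] ->.
- by rewrite one (inj_eq (@lift_inj _ _)).
- by rewrite psdZr er mulr0 eq_sym (negPf (neq_lift _ _)).
- by rewrite psdZl psd_herm er conjC0 mulr0 (negPf (neq_lift _ _)).
- by rewrite psdZl psdZr cr ccr eqxx.
Qed.

Definition definite := forall x, b x x = 0 -> x = 0.
End Forms.

Section FormsFinite.
Variables (C : numClosedFieldType) (V : vectType C) (b : V -> V -> C).
Hypotheses (bP : psd_form b).

Lemma orthonormal_leq_dim k (e : 'I_k -> V) : orthonormal_family b e -> (k <= \dim {:V})%N.
Proof.
move=> one; pose X := [tuple e i | i < k].
have : free X.
  apply/freeP => c c0 i; have := congr1 (b (e i)) c0.
  rewrite (psd0r bP) (psd_sumr bP) (bigD1 i) //= (psdZr bP) nth_mktuple one.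
  rewrite eqxx mulr1 big1 ?addr0 // => j ji.
  by rewrite (psdZr bP) nth_mktuple one eq_sym (negPf ji) mulr0.
rewrite /free => /eqP; rewrite size_tuple => <-; apply: dimvS; exact: subvf.
Qed.

Lemma orthonormal_basis (W : set V) : definite b -> subspace W ->
  exists k (e : 'I_k -> V), [/\ forall i, W (e i), orthonormal_family b e &
    forall x, W x -> x = \sum_i b (e i) x *: e i].
Proof.
move=> db sW.
have [//|k e _ one|k [e [We one h]]] := @maximal_orthonormal _ _ _ bP W (\dim {:V}).
  exact: orthonormal_leq_dim.
exists k, e; split=> // x Wx; apply/eqP; rewrite -subr_eq0; apply/eqP.
exact/db/h.
Qed.

Lemma orthogonal_decomposition (W : set V) x : definite b -> subspace W ->
  exists y, W y /\ forall z, W z -> b z (x - y) = 0.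
Proof.
move=> db sW; have [k [e [We one h]]] := orthonormal_basis db sW.
exists (\sum_i b (e i) x *: e i); split.
  by apply: subspace_sum => // i _; apply: subspaceZ.
move=> z Wz; rewrite (h z Wz) (psd_suml bP) big1 // => i _.
rewrite (psdZl bP) (psdBr bP) (psd_sumr bP) (bigD1 i) //= (psdZr bP) one eqxx.
rewrite mulr1 big1 ?addr0 ?subrr ?mulr0 // => j ji.
by rewrite (psdZr bP) one eq_sym (negPf ji) mulr0.
Qed.

End FormsFinite.

Section MatrixForm.
Variable C : numClosedFieldType.

Lemma conjtrK m n (A : 'M[C]_(m, n)) : A^*t^*t = A.
Proof. exact: trmxCK. Qed.

Lemma conjtrM m n k (A : 'M[C]_(m, n)) (B : 'M_(n, k)) :
  (A *m B)^*t = B^*t *m A^*t.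
Proof. by rewrite trmx_mul map_mxM. Qed.

(** The Frobenius inner product. *)
Definition mxdot m n (A B : 'M[C]_(m, n)) : C := \tr (A^*t *m B).

Lemma mxdotE m n (A B : 'M[C]_(m, n)) : mxdot A B = \sum_j \sum_i (A i j)^* * B i j.
Proof.
by apply: eq_bigr => j _; rewrite mxE; apply: eq_bigr => i _; rewrite !mxE.
Qed.

Lemma conj_mul_ge0 (z : C) : 0 <= z^* * z.
Proof. by rewrite mulrC mul_conjC_ge0. Qed.

Lemma mxdot_psd m n : psd_form (@mxdot m n).
Proof.
split=> [A a B D|a A B D|A].
- by rewrite /mxdot mulmxDr -scalemxAr linearD linearZ.
- rewrite /mxdot !linearD /= map_mxD mulmxDl linearD /=; congr (_ + _).
  by rewrite linearZ /= map_mxZ -scalemxAl linearZ.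
- by rewrite mxdotE; do 2!apply: sumr_ge0 => ? _; apply: conj_mul_ge0.
Qed.

Lemma mxdot_definite m n : definite (@mxdot m n).
Proof.
move=> A; rewrite mxdotE => h; apply/matrixP => i j; rewrite mxE.
have /eqP := h; rewrite psumr_eq0; last first.
  by move=> ? _; apply: sumr_ge0 => ? _; apply: conj_mul_ge0.
move/allP/(_ j (mem_index_enum _))/eqP/eqP.
rewrite psumr_eq0; last by move=> ? _; apply: conj_mul_ge0.
move/allP/(_ i (mem_index_enum _)); rewrite /= mulf_eq0 conjC_eq0 orbb.
by move/eqP.
Qed.

(** The isometry [J] is kept, and not only the projection [J *m J^*t], because
corepresentations are compressed along it. *)
Lemma subspace_isometry n (W : set 'cV[C]_n) : subspace W ->
  exists k (J : 'M[C]_(n, k)), J^*t *m J = 1%:M /\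
    forall w, W w <-> J *m J^*t *m w = w.
Proof.
move=> sW.
have [k [e [We one h]]] :=
  orthonormal_basis (@mxdot_psd n 1) (@mxdot_definite n 1) sW.
exists k, (\matrix_(i, j) e j i 0).
have JJ (w : 'cV_n) : (\matrix_(i, j) e j i 0) *m ((\matrix_(i, j) e j i 0)^*t *m w)
    = \sum_i mxdot (e i) w *: e i.
  apply/matrixP => i o; rewrite ord1 mxE summxE; apply: eq_bigr => j _.
  rewrite !mxE mulrC mxdotE big_ord1; congr (_ * _).
  by apply: eq_bigr => l _; rewrite !mxE.
split.
  apply/matrixP => i j; rewrite !mxE -one mxdotE big_ord1.
  by apply: eq_bigr => l _; rewrite !mxE.
move=> w; rewrite -mulmxA JJ; split=> [/h //|<-].
by apply: subspace_sum => // i _; apply: subspaceZ.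
Qed.

End MatrixForm.

(** * Square roots of hermitian matrices inside a matrix algebra *)
Section Spectral.
Variable C : numClosedFieldType.

Lemma poly_interpolation (F : C -> C) (s : seq C) :
  exists p : {poly C}, forall x, x \in s -> p.[x] = F x.
Proof.
elim: s => [|a s [p hp]]; first by exists 0.
have [as_|as_] := boolP (a \in s).
  by exists p => x; rewrite inE => /orP [/eqP ->|]; apply: hp.
pose q := \prod_(x <- s) ('X - x%:P).
have qa : q.[a] != 0 by rewrite -[_ == 0]/(root q a) root_prod_XsubC.
exists (p + ((F a - p.[a]) / q.[a])%:P * q) => x.
rewrite inE => /orP [/eqP ->|xs]; rewrite !hornerE; first by rewrite divfK // addrC subrK.
have /rootP -> : root q x by rewrite root_prod_XsubC.
by rewrite mulr0 addr0 hp.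
Qed.

(** The positive and negative parts of [y] have square roots that are polynomials
in [y], by interpolation on the spectrum, so they stay in any unital algebra
containing [y]. *)
Lemma hermitian_sqrt_split n (D : set 'M[C]_n) (y : 'M[C]_n) :
  subspace D -> D 1%:M -> (forall A B, D A -> D B -> D (A *m B)) ->
  D y -> y^*t = y ->
  exists g k, [/\ D g, D k, g^*t = g, k^*t = k & g *m k = 0 /\ y = g *m g - k *m k].
Proof.
case: n D y => [|n] D y sD D1 DM Dy yh.
  (* [horner_mx] is defined only in positive dimension *)
  exists 0, 0; have D0 : D 0 by case: sD.
  by split=> //; try split; apply/matrixP => -[].
have Dp p : D (horner_mx y p).
  elim/poly_ind: p => [|p c hp]; first by rewrite rmorph0; case: sD.
  rewrite rmorphD rmorphM /= horner_mx_X horner_mx_C -scalemx1.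
  by rewrite addrC; case: sD => _; apply=> //; apply: DM.
have yN : y \is normalmx by apply/normalmxP; rewrite -/(_^*t) yh.
have := orthomx_spectralP yN.
set U := spectralmx y; set d := spectral_diag y => yE.
have Uu : U \in unitmx := spectral_unit y.
have dr : d \is a mxOver Num.real.
  apply: hermitian_spectral_diag_real.
  by apply/is_hermitianmxP; rewrite expr0 scale1r -/(_^*t) yh.
have {}dr i : d 0 i \is Num.real by move/mxOverP: dr.
have hp p : horner_mx y p = U^*t *m diag_mx (map_mx (horner p) d) *m U.
  by rewrite [in LHS]yE horner_mx_uconjC // horner_mx_diag invmx_unitary // spectral_unitarymx.
have ip (F : C -> C) : exists p, forall i, (map_mx (horner p) d) 0 i = F (d 0 i).
  have [p hF] := poly_interpolation F [seq d 0 i | i : 'I_n.+1].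
  by exists p => i; rewrite mxE hF // map_f // mem_enum.
have [p hF] := ip (fun x => if 0 <= x then sqrtC x else 0).
have [q hG] := ip (fun x => if 0 <= x then 0 else sqrtC (- x)).
have UU : U *m U^*t = 1%:M by apply/unitarymxP; apply: spectral_unitarymx.
have herm (e : 'rV[C]_n.+1) : (forall i, e 0 i \is Num.real) ->
    (U^*t *m diag_mx e *m U)^*t = U^*t *m diag_mx e *m U.
  move=> er; rewrite !trmx_mul !map_mxM /= tr_diag_mx map_diag_mx -map_trmx trmxK.
  rewrite -map_mx_comp (map_mx_id (@conjCK _)) mulmxA; congr (_ *m diag_mx _ *m _).
  by apply/matrixP => i j; rewrite ord1 mxE; apply/CrealP.
have prod (e f : 'rV[C]_n.+1) : (U^*t *m diag_mx e *m U) *m (U^*t *m diag_mx f *m U)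
   = U^*t *m diag_mx (\row_i (e 0 i * f 0 i)) *m U.
  rewrite !mulmxA -[_ *m U *m U^*t]mulmxA UU mulmx1 -[_ *m diag_mx f]mulmxA.
  by rewrite mulmx_diag.
exists (horner_mx y p), (horner_mx y q); split=> //.
- rewrite hp herm // => i; rewrite hF; case: ifP => // h.
  by rewrite ger0_real // sqrtC_ge0.
- rewrite hp herm // => i; rewrite hG; case: ifP => // h.
  case: (real_leP (real0 C) (dr i)) h => // /ltW h _.
  by rewrite ger0_real // sqrtC_ge0 oppr_ge0.
split; rewrite !hp !prod.
  rewrite [\row_i _](_ : _ = 0).
    by rewrite linear0 mulmx0 mul0mx.
  by apply/rowP => i; rewrite mxE hF hG mxE; case: ifP; rewrite ?mulr0 ?mul0r.
rewrite {1}yE invmx_unitary ?spectral_unitarymx // -mulmxBl -mulmxBr.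
rewrite -linearB /=; congr (_ *m diag_mx _ *m _); apply/rowP => i.
have := hF i; have := hG i; rewrite !mxE => -> ->.
by case: ifP; rewrite ?mulr0 -expr2 sqrtCK ?subr0 // sub0r opprK.
Qed.
End Spectral.

(** * Unitary corepresentations and their coefficients *)
Arguments star {R h} _.
Arguments comul {R h}.
Arguments counit {R h}.
Arguments antipode {R h}.
Section Corepresentations.
Variables (R : realType) (H : hopfStarAlg R).
Local Notation C := R[i].
Implicit Types x y : H.

(** Scalar matrices are viewed with entries in [H] so that they multiply
matrices of elements of [H]. *)
Definition sc m n (p : 'M[C]_(m, n)) : 'M[H]_(m, n) := map_mx (in_alg H) p.

Lemma sc1 n : sc (1%:M : 'M_n) = 1%:M.
Proof. exact: map_mx1. Qed.
Lemma scM m n k (p : 'M_(m, n)) (q : 'M_(n, k)) : sc (p *m q) = sc p *m sc q.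
Proof. exact: map_mxM. Qed.
Lemma scE m n (p : 'M_(m, n)) i j : sc p i j = (p i j)%:A.
Proof. by rewrite mxE. Qed.
Lemma mul_scE m n k (p : 'M_(m, n)) (u : 'M[H]_(n, k)) i j :
  (sc p *m u) i j = \sum_l p i l *: u l j.
Proof. by rewrite mxE; apply: eq_bigr => l _; rewrite scE mulr_algl. Qed.
Lemma mulsc_E m n k (u : 'M[H]_(m, n)) (p : 'M_(n, k)) i j :
  (u *m sc p) i j = \sum_l p l j *: u i l.
Proof. by rewrite mxE; apply: eq_bigr => l _; rewrite scE mulr_algr. Qed.

(* star *)
Lemma star_invol x : star (star x) = x.
Proof. by case: (starP H) => h _ _ _; apply: h. Qed.
Lemma starD x y : star (x + y) = star x + star y.
Proof. by case: (starP H) => _ h _ _; apply: h. Qed.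
Lemma starZ (a : C) x : star (a *: x) = a^* *: star x.
Proof. by case: (starP H) => _ _ h _; apply: h. Qed.
Lemma starM x y : star (x * y) = star y * star x.
Proof. by case: (starP H) => _ _ _ h; apply: h. Qed.
Lemma star0 : star (0 : H) = 0.
Proof. by apply: (addrI (star 0)); rewrite -starD !addr0. Qed.
Lemma star1 : star (1 : H) = 1.
Proof. by rewrite -[RHS]star_invol -[star 1 in RHS]mulr1 starM star_invol mulr1. Qed.
Lemma star_sum I (r : seq I) (P : pred I) F :
  star (\sum_(i <- r | P i) F i) = \sum_(i <- r | P i) star (F i) :> H.
Proof. by apply: (big_morph (@star _ H) starD star0). Qed.

Definition adj m n (u : 'M[H]_(m, n)) : 'M[H]_(n, m) := map_mx star u^T.

Lemma adjE m n (u : 'M[H]_(m, n)) i j : adj u i j = star (u j i).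
Proof. by rewrite !mxE. Qed.
Lemma adjK m n (u : 'M[H]_(m, n)) : adj (adj u) = u.
Proof. by apply/matrixP => i j; rewrite !adjE star_invol. Qed.
Lemma adjM m n k (u : 'M[H]_(m, n)) (v : 'M_(n, k)) : adj (u *m v) = adj v *m adj u.
Proof.
apply/matrixP => i j; rewrite adjE !mxE star_sum; apply: eq_bigr => l _.
by rewrite starM !adjE.
Qed.
Lemma adj_sc m n (p : 'M_(m, n)) : adj (sc p) = sc p^*t.
Proof. by apply/matrixP => i j; rewrite !mxE starZ star1. Qed.

(* functionals applied to the entries of a matrix *)
Lemma fun_mulsc m n k (f : {scalar H}) (u : 'M_(m, n)) (p : 'M_(n, k)) :
  map_mx f (u *m sc p) = map_mx f u *m p.
Proof.
apply/matrixP => i j; rewrite mxE mulsc_E linear_sum mxE; apply: eq_bigr => l _.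
by rewrite linearZ /= mxE mulrC.
Qed.
Lemma fun_scmul m n k (f : {scalar H}) (u : 'M_(n, k)) (p : 'M_(m, n)) :
  map_mx f (sc p *m u) = p *m map_mx f u.
Proof.
apply/matrixP => i j; rewrite mxE mul_scE linear_sum mxE; apply: eq_bigr => l _.
by rewrite linearZ /= mxE.
Qed.
Lemma mx_functional_ext m n (u v : 'M[H]_(m, n)) :
  (forall f : {scalar H}, map_mx f u = map_mx f v) -> u = v.
Proof.
move=> h; apply/matrixP => i j; apply: functional_ext => f.
by have /matrixP/(_ i j) := h f; rewrite !mxE.
Qed.

(** Unitarity is separated from the comultiplication rule since some arguments
apply to cut-down matrices such as [u (1 - p)], which are not unitary. *)
Definition corep n (u : 'M[H]_n) :=
  forall i j, comul (u i j) = \sum_k tens (u i k) (u k j).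

Lemma unitaryP n (u : 'M[H]_n) : unitary_corep u ->
  [/\ corep u, forall i j, counit (u i j) = (i == j)%:R, u *m adj u = 1%:M
    & adj u *m u = 1%:M].
Proof. by []. Qed.

(** The coefficients of [u], in trace form: for a rank one matrix
[c = w *m v^*t] this is the usual matrix coefficient of [v] and [w]. *)
Definition matcoef n (u : 'M[H]_n) (c : 'M[C]_n) : H := \tr (sc c *m u).

Lemma matcoefE n (u : 'M_n) c : matcoef u c = \sum_i \sum_j c i j *: u j i.
Proof. by apply: eq_bigr => i _; rewrite mul_scE. Qed.

Lemma matcoef_linear n (u : 'M_n) : linear (matcoef u).
Proof.
move=> a c d; rewrite !matcoefE scaler_sumr -big_split; apply: eq_bigr => i _ /=.
rewrite scaler_sumr -big_split; apply: eq_bigr => j _ /=.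
by rewrite !mxE scalerDl scalerA.
Qed.
HB.instance Definition _ n (u : 'M[H]_n) :=
  GRing.isLinear.Build C 'M[C]_n H _ (matcoef u) (matcoef_linear u).

Lemma matcoef0 n (u : 'M_n) : matcoef u 0 = 0.
Proof. exact: linear0. Qed.
Lemma matcoefB n (u : 'M_n) c d : matcoef u (c - d) = matcoef u c - matcoef u d.
Proof. exact: linearB. Qed.
Lemma matcoefZ n (u : 'M_n) a c : matcoef u (a *: c) = a *: matcoef u c.
Proof. exact: linearZ. Qed.

Lemma matcoef_mulr n (u : 'M_n) (c p : 'M[C]_n) :
  sc p *m u = u *m sc p -> matcoef u (c *m p) = matcoef u (p *m c).
Proof.
move=> pu; rewrite /matcoef !scM -mulmxA pu mulmxA -[in RHS]mulmxA /mxtrace.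
under eq_bigr do rewrite mulsc_E.
by rewrite exchange_big; apply: eq_bigr => i _; rewrite [RHS]mul_scE.
Qed.

Lemma matcoef_delta n (u : 'M_n) i j : matcoef u (delta_mx j i) = u i j.
Proof.
rewrite matcoefE (bigD1 j) //= (bigD1 i) //= !mxE !eqxx scale1r big1; last first.
  by move=> k ki; rewrite mxE (negPf ki) andbF scale0r.
rewrite addr0 big1 ?addr0 // => k kj; apply: big1 => l _.
by rewrite mxE (negPf kj) scale0r.
Qed.

Lemma slice_r_corep n (u : 'M_n) (f : {scalar H}) i j : corep u ->
  slice_r f (comul (u i j)) = \sum_k f (u k j) *: u i k.
Proof.
by move=> cu; rewrite cu linear_sum; apply: eq_bigr => k _; rewrite [LHS]slice_r_tens.
Qed.

Lemma slice_l_corep n (u : 'M_n) (f : {scalar H}) i j : corep u ->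
  slice_l f (comul (u i j)) = \sum_k f (u i k) *: u k j.
Proof.
by move=> cu; rewrite cu linear_sum; apply: eq_bigr => k _; rewrite [LHS]slice_l_tens.
Qed.

Lemma slice_r_mulsc m n k (f : {scalar H}) (s : 'M_(m, n)) (u : 'M_n)
    (w : 'M_(n, k)) i j : corep u ->
  slice_r f (comul ((sc s *m (u *m sc w)) i j)) =
  (sc s *m (u *m sc (map_mx f u *m w))) i j.
Proof.
move=> cu; rewrite [sc s *m _ in LHS]lock [sc s *m _ in RHS]lock -!lock.
rewrite !mul_scE !linear_sum; apply: eq_bigr => l _.
rewrite !linearZ /=; congr (_ *: _).
rewrite !mulsc_E !linear_sum.
under eq_bigr do rewrite !linearZ /= slice_r_corep // scaler_sumr.
rewrite exchange_big; apply: eq_bigr => a _ /=.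
rewrite mxE scaler_suml; apply: eq_bigr => c _.
by rewrite scalerA mxE mulrC.
Qed.

Lemma slice_r_coef n (f : {scalar H}) (u : 'M_n) c : corep u ->
  slice_r f (comul (matcoef u c)) = matcoef u (map_mx f u *m c).
Proof.
move=> cu; transitivity (\sum_i \sum_j \sum_k (c i j * f (u k i)) *: u j k).
  rewrite matcoefE !linear_sum; apply: eq_bigr => i _.
  rewrite !linear_sum; apply: eq_bigr => j _.
  rewrite !linearZ /= slice_r_corep // scaler_sumr.
  by apply: eq_bigr => k _; rewrite scalerA.
under eq_bigr do rewrite exchange_big /=.
rewrite exchange_big matcoefE; apply: eq_bigr => k _ /=.
rewrite exchange_big; apply: eq_bigr => j _ /=.
rewrite mxE scaler_suml; apply: eq_bigr => i _.
by rewrite mxE mulrC.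
Qed.

Lemma slice_l_matcoef n (f : {scalar H}) (u : 'M[H]_n) c : corep u ->
  slice_l f (comul (matcoef u c)) = matcoef u (c *m map_mx f u).
Proof.
move=> cu; transitivity (\sum_i \sum_j \sum_k (c i j * f (u j k)) *: u k i).
  rewrite matcoefE !linear_sum; apply: eq_bigr => i _.
  rewrite !linear_sum; apply: eq_bigr => j _.
  rewrite !linearZ /= slice_l_corep // scaler_sumr.
  by apply: eq_bigr => k _; rewrite scalerA.
rewrite matcoefE; apply: eq_bigr => i _; rewrite exchange_big; apply: eq_bigr => k _ /=.
by rewrite mxE scaler_suml; apply: eq_bigr => j _; rewrite mxE.
Qed.

Lemma mul_balanced (G : algType C) (f g : {linear H -> G}) :
  balanced (fun a b => f a * g b).
Proof.
split=> [x x' y|x y y'|a x y]; rewrite ?linearD ?mulrDl ?mulrDr //.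
by rewrite !linearZ /= -scalerAl -scalerAr.
Qed.

Lemma tlift_mul_corep (G : algType C) (f g : {linear H -> G}) n (u : 'M_n) i j :
  corep u ->
  tlift (fun a b => f a * g b) (comul (u i j)) = \sum_k f (u i k) * g (u k j).
Proof.
move=> cu; have b := mul_balanced f g.
by rewrite cu tlift_sum //; apply: eq_bigr => k _; rewrite tlift_tens.
Qed.

(** Both matrices are inverse to [u]: one by the antipode axiom, the other by
unitarity. *)
Lemma antipode_corep n (u : 'M[H]_n) : unitary_corep u -> map_mx antipode u = adj u.
Proof.
move=> /unitaryP [cu eu uu _].
suff Su : map_mx antipode u *m u = 1%:M by rewrite -[LHS]mulmx1 -uu mulmxA Su mul1mx.
apply/matrixP => i j; have := antipodel (u i j).
rewrite (tlift_mul_corep antipode idfun) // eu => e; rewrite !mxE.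
transitivity (\sum_k antipode (u i k) * idfun (u k j)).
  by apply: eq_bigr => k _; rewrite mxE.
by rewrite e; case: eqP; rewrite ?scale1r ?scale0r.
Qed.

(** The counit with values in [C] rather than in the module [C^o]. *)
Definition eps : H -> C := counit.
Lemma eps_scalar : scalar eps.
Proof. exact: (linearP (@counit _ H)). Qed.
HB.instance Definition _ := GRing.isLinear.Build C H C _ eps eps_scalar.
Lemma eps_monoid : monoid_morphism eps.
Proof. by split; [exact: (rmorph1 (@counit _ H))|exact: (rmorphM (@counit _ H))]. Qed.
HB.instance Definition _ := GRing.isMonoidMorphism.Build H C eps eps_monoid.

Lemma eps_unitary n (u : 'M[H]_n) : unitary_corep u -> map_mx eps u = 1%:M.
Proof. by case=> _ e _ _; apply/matrixP => i j; rewrite !mxE [LHS]e. Qed.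

(* invariant subspaces *)
(** An isometric corner of a unitary matrix over an infinite-dimensional algebra
need not be unitary, so unitarity of [u] alone does not make the complement
invariant. Applying the antipode to the invariance relation turns [u] into its
adjoint, and taking adjoints gives the missing relation. *)
Lemma invariant_projection n (u : 'M[H]_n) (p : 'M[C]_n) : unitary_corep u ->
  p^*t = p -> sc p *m u *m sc p = u *m sc p -> sc p *m u = u *m sc p.
Proof.
move=> uc ph pup.
have /(congr1 (map_mx antipode)) := pup.
have S1 m k (v : 'M[H]_(n, m)) (q : 'M_(m, k)) :
    map_mx antipode (v *m sc q) = map_mx antipode v *m sc q.
  apply/matrixP => i j; rewrite mxE mulsc_E linear_sum mulsc_E.
  by apply: eq_bigr => l _; rewrite linearZ mxE.
have S2 m k (v : 'M[H]_(m, k)) (q : 'M_(n, m)) :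
    map_mx antipode (sc q *m v) = sc q *m map_mx antipode v.
  apply/matrixP => i j; rewrite mxE !mul_scE linear_sum.
  by apply: eq_bigr => l _; rewrite linearZ mxE.
rewrite !S1 S2 antipode_corep // => /(congr1 (@adj _ _)).
rewrite !adjM adjK !adj_sc ph mulmxA => <-.
by rewrite pup.
Qed.

Lemma invariant_subspace n (u : 'M[H]_n) (Z : set 'cV[C]_n) :
  unitary_corep u -> subspace Z ->
  (forall (f : {scalar H}) z, Z z -> Z (map_mx f u *m z)) ->
  exists k (J : 'M[C]_(n, k)), [/\ J^*t *m J = 1%:M,
    forall w, Z w <-> J *m J^*t *m w = w
  & sc (J *m J^*t) *m u = u *m sc (J *m J^*t)].
Proof.
move=> uc sZ inv; have [k [J [JJ ZJ]]] := subspace_isometry sZ.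
exists k, J; split=> //; set p := J *m J^*t.
have pp : p *m p = p by rewrite /p mulmxA -[_ *m J]mulmxA JJ mulmx1.
apply: invariant_projection => //.
  by rewrite /p conjtrM conjtrK.
apply: mx_functional_ext => f; rewrite !fun_mulsc fun_scmul -mulmxA.
apply/matrixP => i j; have Zp : Z (p *m delta_mx j 0) by apply/ZJ; rewrite -/p mulmxA pp.
have /ZJ := inv f _ Zp; rewrite -/p !mulmxA -!colE -mulmxA => /matrixP/(_ i 0).
by rewrite [LHS]mxE [X in _ = X]mxE => <-.
Qed.

End Corepresentations.
Arguments eps {R H} _.

(** * Direct sums and tensor products of corepresentations *)
Lemma sum_enum_val (U : nmodType) (T : finType) (F : T -> U) :
  \sum_c F c = \sum_(i < #|T|) F (enum_val i).
Proof. by rewrite -(big_enum_val F); apply: eq_bigl. Qed.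

Lemma sum_pair (U : nmodType) (I J : finType) (F : I * J -> U) :
  \sum_x F x = \sum_i \sum_j F (i, j).
Proof. by rewrite pair_bigA; apply: eq_bigr => -[]. Qed.

Section Constructions.
Variables (R : realType) (H : hopfStarAlg R).
Local Notation C := R[i].
Local Notation tensHH := (@tens C H H).

Lemma tens0l (y : H) : tensHH 0 y = 0.
Proof. by rewrite -[0 in LHS](scale0r (0 : H)) -scale_tens scale0r. Qed.
Lemma tens0r (x : H) : tensHH x 0 = 0.
Proof. by rewrite -[0 in LHS](scale0r (0 : H)) -tensZC -scale_tens scale0r. Qed.

Lemma comulM (x y : H) : comul (x * y) = comul x * comul y.
Proof. by case: (comul_monoid_morphism H) => _ h; apply: h. Qed.
Lemma comul_star_corep n (u : 'M[H]_n) i j : corep u ->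
  comul (star (u i j)) = \sum_k tens (star (u i k)) (star (u k j)).
Proof.
move=> cu; rewrite comul_star cu /tmap.
have b : balanced (fun x y => @tens C H H (star x) (star y)).
  split=> [x x' y|x y y'|a x y]; rewrite ?starD ?tensDl ?tensDr //.
  by rewrite !starZ tensZC.
by rewrite tlift_sum //; apply: eq_bigr => r _; rewrite tlift_tens.
Qed.

Section DirectSum.
Variables (n m : nat) (u : 'M[H]_n) (v : 'M[H]_m).

Lemma unitary_dsum : unitary_corep u -> unitary_corep v ->
  unitary_corep (block_mx u 0 0 v).
Proof.
move=> /unitaryP [cu eu uu u'u] /unitaryP [cv ev vv v'v].
have adjb : map_mx star (block_mx u 0 0 v)^T = block_mx (adj u) 0 0 (adj v).
  rewrite tr_block_mx map_block_mx; congr block_mx;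
  by apply/matrixP => i j; rewrite !mxE star0.
split.
- move=> i j; rewrite big_split_ord /=.
  case: (split_ordP i) => i' ->; case: (split_ordP j) => j' ->;
  rewrite ?(block_mxEul, block_mxEur, block_mxEdl, block_mxEdr).
  + rewrite cu [X in _ + X]big1 ?addr0 => [|k _].
      by apply: eq_bigr => k _; rewrite !block_mxEul.
    by rewrite block_mxEur block_mxEdl mxE tens0l.
  + rewrite mxE linear0 !big1 ?addr0 // => k _;
    by rewrite ?(block_mxEul, block_mxEur, block_mxEdl, block_mxEdr) mxE ?tens0l ?tens0r.
  + rewrite mxE linear0 !big1 ?addr0 // => k _;
    by rewrite ?(block_mxEul, block_mxEur, block_mxEdl, block_mxEdr) mxE ?tens0l ?tens0r.
  + rewrite cv [X in X + _]big1 ?add0r => [|k _].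
      by apply: eq_bigr => k _; rewrite !block_mxEdr.
    by rewrite block_mxEur block_mxEdl mxE tens0l.
- move=> i j.
  case: (split_ordP i) => i' ->; case: (split_ordP j) => j' ->;
  rewrite ?(block_mxEul, block_mxEur, block_mxEdl, block_mxEdr) ?eu ?ev
    ?(inj_eq (@lshift_inj _ _)) ?(inj_eq (@rshift_inj _ _)) //
    ?eq_lrshift ?eq_rlshift mxE; exact: linear0.
- by rewrite adjb mulmx_block uu vv !(mulmx0, mul0mx, addr0, add0r) -scalar_mx_block.
- by rewrite adjb mulmx_block u'u v'v !(mulmx0, mul0mx, addr0, add0r) -scalar_mx_block.
Qed.

Lemma matcoef_dsum (c : 'M_(n + m)) :
  matcoef (block_mx u 0 0 v) c = matcoef u (ulsubmx c) + matcoef v (drsubmx c).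
Proof.
rewrite /matcoef -[c in LHS]submxK /sc map_block_mx mulmx_block mxtrace_block.
by rewrite !mulmx0 addr0 add0r.
Qed.
End DirectSum.

Lemma unitary_scalar0 : unitary_corep (0 : 'M[H]_0).
Proof. by split; try (by case); apply/matrixP => -[]. Qed.

(** Corepresentations indexed by a finite type such as a product of ordinals are
renumbered to meet the definition by ['I_n]-indexed matrices. *)
Lemma unitary_fin (T : finType) (t : T -> T -> H) :
  (forall a b, comul (t a b) = \sum_c tens (t a c) (t c b)) ->
  (forall a b, eps (t a b) = (a == b)%:R) ->
  (forall a b, \sum_c t a c * star (t b c) = (a == b)%:R) ->
  (forall a b, \sum_c star (t c a) * t c b = (a == b)%:R) ->
  unitary_corep (\matrix_(i, j < #|T|) t (enum_val i) (enum_val j)).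
Proof.
move=> ht et tt t't; split=> [i j|i j||].
- rewrite mxE ht [LHS]sum_enum_val.
  by apply: eq_bigr => k _; rewrite !mxE.
- by rewrite mxE [LHS]et (inj_eq enum_val_inj).
- apply/matrixP => i j; rewrite !mxE -(inj_eq enum_val_inj) -tt [RHS]sum_enum_val.
  by apply: eq_bigr => k _; rewrite !mxE.
- apply/matrixP => i j; rewrite !mxE -(inj_eq enum_val_inj) -t't [RHS]sum_enum_val.
  by apply: eq_bigr => k _; rewrite !mxE.
Qed.

Section Product.
Variables (n m : nat) (b : 'M[H]_n) (u : 'M[H]_m).
Definition tprod (x y : 'I_n * 'I_m) : H := b x.1 y.1 * u x.2 y.2.
Definition tprod_mx := \matrix_(i, j < #|{: 'I_n * 'I_m}|) tprod (enum_val i) (enum_val j).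

Lemma unitary_tprod : unitary_corep b -> unitary_corep u -> unitary_corep tprod_mx.
Proof.
move=> /unitaryP [cb eb bb b'b] /unitaryP [cu eu uu u'u].
apply: unitary_fin => [[i k] [j l]|[i k] [j l]|[i k] [j l]|[i k] [j l]]; rewrite /tprod /=.
- rewrite comulM cb cu mulr_suml.
  under [LHS]eq_bigr do rewrite mulr_sumr.
  rewrite pair_bigA; apply: eq_bigr => -[a c] _ /=.
  by rewrite mul_tens.
- by rewrite rmorphM /= [eps (b i j)]eb [eps (u k l)]eu -natrM mulnb.
- transitivity (\sum_a b i a * (\sum_c u k c * star (u l c)) * star (b j a)).
    under [RHS]eq_bigr do rewrite mulr_sumr mulr_suml.
    by rewrite pair_bigA; apply: eq_bigr => -[a c] _ /=; rewrite starM !mulrA.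
  have -> : \sum_c u k c * star (u l c) = (k == l)%:R.
    move/matrixP: uu => /(_ k l); rewrite !mxE => <-.
    by apply: eq_bigr => c _; rewrite adjE.
  have /matrixP/(_ i j) := bb; rewrite !mxE xpair_eqE => e.
  case: (k == l); last by rewrite andbF big1 // => a _; rewrite mulr0 mul0r.
  by rewrite andbT -e; apply: eq_bigr => a _; rewrite mulr1 adjE.
- transitivity (\sum_c star (u c k) * (\sum_a star (b a i) * b a j) * u c l).
    under [RHS]eq_bigr do rewrite mulr_sumr mulr_suml.
    rewrite exchange_big pair_bigA.
    by apply: eq_bigr => -[a c] _ /=; rewrite starM !mulrA.
  have -> : \sum_a star (b a i) * b a j = (i == j)%:R.
    move/matrixP: b'b => /(_ i j); rewrite !mxE => <-.
    by apply: eq_bigr => c _; rewrite adjE.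
  have /matrixP/(_ k l) := u'u; rewrite !mxE xpair_eqE => e.
  case: (i == j); last by rewrite big1 // => a _; rewrite mulr0 mul0r.
  by rewrite -e; apply: eq_bigr => a _; rewrite mulr1 adjE.
Qed.
End Product.

Hypothesis Hc : compact_hopf H.

(** A linear combination of coefficients is a single vector coefficient of the
direct sum of the corepresentations involved. *)
Lemma compact_rank1 (x : H) : exists n (u : 'M[H]_n) (v w : 'cV[C]_n),
  unitary_corep u /\ x = matcoef u (w *m v^*t).
Proof.
have [s [hs ->]] := Hc x; elim: s hs => [|[a y] s ih] hs.
  by exists 0, 0, 0, 0; split; [exact: unitary_scalar0|rewrite big_nil mul0mx linear0].
have [|n [u [v [w [uc e]]]]] := ih.
  by move=> p ps; apply: hs; rewrite inE ps orbT.
have [m [u' [i [j [u'c ->]]]]] : unitary_coef y by apply: (hs (a, y)); rewrite mem_head.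
exists (m + n)%N, (block_mx u' 0 0 u), (col_mx (a^* *: delta_mx i 0) v),
  (col_mx (delta_mx j 0) w); split; first exact: unitary_dsum.
rewrite big_cons e matcoef_dsum /= tr_col_mx map_row_mx mul_col_row.
rewrite block_mxKul block_mxKdr; congr (_ + _).
rewrite linearZ /= map_mxZ /= conjCK -scalemxAr linearZ /=; congr (_ *: _).
by rewrite trmx_delta map_delta_mx mul_delta_mx matcoef_delta.
Qed.

Lemma compact_family (s : seq H) : exists n (u : 'M[H]_n),
  unitary_corep u /\ forall x, x \in s -> exists c, x = matcoef u c.
Proof.
elim: s => [|x s [n [u [uc h]]]].
  by exists 0, 0; split; first exact: unitary_scalar0.
have [m [u' [v [w [u'c xE]]]]] := compact_rank1 x.
exists (m + n)%N, (block_mx u' 0 0 u); split; first exact: unitary_dsum.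
move=> y; rewrite inE => /orP [/eqP ->|/h [c ->]].
  exists (block_mx (w *m v^*t) 0 0 0).
  by rewrite matcoef_dsum block_mxKul block_mxKdr linear0 addr0.
exists (block_mx 0 0 0 c).
by rewrite matcoef_dsum block_mxKul block_mxKdr linear0 add0r.
Qed.

Lemma matcoef_ind (P : H -> Prop) : P 0 -> (forall a x y, P x -> P y -> P (a *: x + y)) ->
  (forall n (u : 'M[H]_n), unitary_corep u -> forall i j, P (u i j)) -> forall x, P x.
Proof.
move=> P0 PD Pu x; have [s [hs ->]] := Hc x; elim: s hs => [|[a y] s ih] hs.
  by rewrite big_nil.
rewrite big_cons; apply: PD; last by apply: ih => p ps; apply: hs; rewrite inE ps orbT.
have [m [u' [i [j [u'c ->]]]]] : unitary_coef y by apply: (hs (a, y)); rewrite mem_head.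
exact: Pu.
Qed.

Lemma eps_star (x : H) : eps (star x) = (eps x)^*.
Proof.
move: x; apply: matcoef_ind => [|a x y hx hy|n u uc i j].
- by rewrite star0 !linear0 conjC0.
- by rewrite starD starZ !linearD !linearZ /= rmorphD rmorphM /= hx hy.
have [_ _ uu _] := unitaryP uc.
have := congr1 (map_mx eps) uu; rewrite map_mxM /= map_mx1 eps_unitary // mul1mx.
move/matrixP/(_ j i); rewrite !mxE => ->.
have /matrixP/(_ i j) := eps_unitary uc; rewrite !mxE => ->.
by rewrite conjC_nat eq_sym.
Qed.

End Constructions.

(** * The part of a corepresentation with coefficients in a subalgebra *)
Section Subalgebra.
Variables (R : realType) (H : hopfStarAlg R) (A : hopfStarSubalg H).
Local Notation C := R[i].
Local Notation iA := (incl A).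

Definition inA (x : H) : Prop := exists a, iA a = x.

Lemma inA_subspace : subspace inA.
Proof.
split; first by exists 0; rewrite linear0.
by move=> a _ _ [x <-] [y <-]; exists (a *: x + y); rewrite linearP.
Qed.

Lemma inA1 : inA 1. Proof. by exists 1; rewrite rmorph1. Qed.

Lemma inAM x y : inA x -> inA y -> inA (x * y).
Proof. by move=> [a <-] [b <-]; exists (a * b); rewrite rmorphM. Qed.

Lemma inA_star x : inA x -> inA (star x).
Proof. by move=> [a <-]; exists (star a); rewrite incl_star. Qed.

Lemma slice_r_inA (f : {scalar H}) x : inA x -> inA (slice_r f (comul x)).
Proof.
move=> [a <-]; rewrite incl_comul; elim/tensor_ind: (comul a) => [|s t hs ht|y z].
- by rewrite !linear0; case: inA_subspace.
- by rewrite !linearD; apply: subspaceD => //; apply: inA_subspace.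
- rewrite tmap_tens [slice_r _ _]slice_r_tens.
  by apply: subspaceZ; [exact: inA_subspace|exists y].
Qed.

Lemma slice_r_vanish (f : {scalar H}) x : (forall y, inA y -> f y = 0) ->
  inA x -> slice_r f (comul x) = 0.
Proof.
move=> f0 [a <-]; rewrite incl_comul; elim/tensor_ind: (comul a) => [|s t hs ht|y z].
- by rewrite !linear0.
- by rewrite !linearD /= hs ht addr0.
- by rewrite tmap_tens [slice_r _ _]slice_r_tens f0 ?scale0r //; exists z.
Qed.

Definition mxinA m n (u : 'M[H]_(m, n)) := forall i j, inA (u i j).

Lemma mxinAM m n k (u : 'M_(m, n)) (v : 'M_(n, k)) :
  mxinA u -> mxinA v -> mxinA (u *m v).
Proof.
move=> hu hv i j; rewrite mxE; apply: subspace_sum; first exact: inA_subspace.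
by move=> l _; apply: inAM.
Qed.
Lemma mxinA_sc m n (p : 'M_(m, n)) : mxinA (sc H p).
Proof.
by move=> i j; rewrite mxE; apply: subspaceZ; [exact: inA_subspace|exact: inA1].
Qed.
Lemma mxtrace_inA n (u : 'M_n) : mxinA u -> inA (\tr u).
Proof. by move=> hu; apply: subspace_sum => //; apply: inA_subspace. Qed.

(** The largest subcomodule of [C^n] whose coefficients lie in [A]. *)
Definition fixA n (u : 'M[H]_n) : set 'cV[C]_n := [set w | mxinA (u *m sc H w)].

Lemma fixA_subspace n (u : 'M[H]_n) : subspace (fixA u).
Proof.
have s := inA_subspace; split=> [i j|a w z hw hz i j].
  by rewrite /sc map_mx0 mulmx0 mxE; case: s.
have -> : (u *m sc H (a *: w + z)) i j = a *: (u *m sc H w) i j + (u *m sc H z) i j.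
  rewrite !mulsc_E scaler_sumr -big_split; apply: eq_bigr => l _ /=.
  by rewrite !mxE scalerDl scalerA.
by case: s => _; apply.
Qed.

(** Such a [p] projects onto [fixA u] along an invariant complement. Orthogonality
is not part of the definition, so that direct sums and tensor products of
adapted pairs are recognized without computing adjoints. *)
Definition adapted n (u : 'M[H]_n) (p : 'M[C]_n) : Prop :=
  [/\ sc H p *m u = u *m sc H p, mxinA (u *m sc H p)
    & forall w, fixA u w -> p *m w = w].

Lemma fixA_functional n (u : 'M[H]_n) (f : {scalar H}) w : corep u ->
  fixA u w -> fixA u (map_mx f u *m w).
Proof.
move=> cu hw i j.
have := slice_r_mulsc f 1%:M w i j cu; rewrite sc1 !mul1mx => <-.
exact: slice_r_inA.
Qed.

Lemma adapted_isometry n (u : 'M[H]_n) : unitary_corep u ->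
  exists k (J : 'M[C]_(n, k)), [/\ J^*t *m J = 1%:M, adapted u (J *m J^*t) &
    mxinA (u *m sc H J)].
Proof.
move=> uc; have [cu _ _ _] := unitaryP uc.
have [k [J [JJ hJ pu]]] := invariant_subspace uc (fixA_subspace u)
   (fun f w => fixA_functional f cu).
exists k, J.
have hcol w : fixA u (J *m J^*t *m w).
  by apply/hJ; rewrite !mulmxA -[_ *m J^*t *m J]mulmxA JJ mulmx1.
have uJ : mxinA (u *m sc H J).
  move=> i j; have := hcol (J *m delta_mx j 0) i 0.
  rewrite !mulmxA -[_ *m J^*t *m J]mulmxA JJ mulmx1 !scM mulmxA.
  rewrite mulsc_E (bigD1 j) //= big1 ?addr0; last first.
    by move=> l lj; rewrite mxE (negPf lj) scale0r.
  by rewrite mxE !eqxx scale1r.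
split=> //; split=> //.
  by rewrite scM mulmxA; apply: mxinAM => //; apply: mxinA_sc.
by move=> w /hJ.
Qed.

Lemma adapted_exists n (u : 'M[H]_n) : unitary_corep u -> exists p, adapted u p.
Proof. by move=> /adapted_isometry [k [J [_ h _]]]; exists (J *m J^*t). Qed.

(** For a unitary matrix [u], applying this functional to the entries gives the
conjugate transpose of applying [f]; thus the set of all matrices
[map_mx f u] is closed under adjoints. *)
Definition adjoint_functional (f : {scalar H}) (x : H) : C :=
  (f (star (antipode x)))^*.

Lemma adjoint_functional_scalar f : scalar (adjoint_functional f).
Proof.
move=> a x y; rewrite /adjoint_functional !linearP starD starZ !linearD linearZ.
by rewrite rmorphD rmorphM /= conjCK.
Qed.
HB.instance Definition _ f :=
  GRing.isLinear.Build C H C _ (adjoint_functional f) (adjoint_functional_scalar f).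

Lemma adjoint_functional_mx f n (u : 'M[H]_n) : unitary_corep u ->
  map_mx (adjoint_functional f) u = (map_mx f u)^*t.
Proof.
move=> uc; apply/matrixP => i j; rewrite !mxE /adjoint_functional.
have /matrixP/(_ i j) := antipode_corep uc; rewrite !mxE => ->.
by rewrite star_invol.
Qed.

(** Let [K] be the space of matrices killed by [p] with zero coefficient, and
replace [c] by its component [d] orthogonal to [K]. The matrices [map_mx f u]
act on [K], and on its orthogonal complement by [adjoint_functional_mx]. If
[f] vanishes on [A], the action of [f] on [d] lies both in [K] and in its
complement, hence is zero. So [u d] has entries in [A], that is, the columns
of [d] are fixed by [p], which also kills them. *)
Lemma matcoef_inA_null n (u : 'M[H]_n) p c : unitary_corep u -> adapted u p ->
  p *m c = 0 -> inA (matcoef u c) -> matcoef u c = 0.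
Proof.
move=> uc [pu _ pW] pc0 cA; have [cu _ _ _] := unitaryP uc.
have pf (f : {scalar H}) : p *m map_mx f u = map_mx f u *m p.
  by rewrite -fun_scmul pu fun_mulsc.
pose K (k : 'M[C]_n) : Prop := p *m k = 0 /\ matcoef u k = 0.
have sK : subspace K.
  split; first by split; [exact: mulmx0 | exact: matcoef0].
  move=> a x y [px cx] [py cy]; split.
    by rewrite mulmxDr -scalemxAr px py scaler0 addr0.
  by rewrite matcoef_linear cx cy scaler0 addr0.
have Kinv (f : {scalar H}) k : K k -> K (map_mx f u *m k).
  move=> [pk ck]; split; first by rewrite mulmxA pf -mulmxA pk mulmx0.
  by rewrite -slice_r_coef // ck !linear0.
have [y [[py cy] yP]] :=
  orthogonal_decomposition (@mxdot_psd _ n n) c (@mxdot_definite _ n n) sK.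
set d := c - y in yP.
have dc : matcoef u d = matcoef u c by rewrite matcoefB cy subr0.
have pd : p *m d = 0 by rewrite mulmxBr pc0 py subr0.
have fd (f : {scalar H}) : (forall x, inA x -> f x = 0) -> map_mx f u *m d = 0.
  move=> f0; apply: mxdot_definite.
  have Kfd : K (map_mx f u *m d).
    split; first by rewrite mulmxA pf -mulmxA pd mulmx0.
    by rewrite -slice_r_coef // dc slice_r_vanish.
  have := yP _ (Kinv (adjoint_functional f) _ Kfd).
  by rewrite adjoint_functional_mx // /mxdot conjtrM conjtrK -mulmxA.
have udA : mxinA (u *m sc H d).
  move=> i j; apply: contrapT => /(separating_functional inA_subspace).
  move=> [f [f0 f1]]; have /matrixP/(_ i j) := fd f f0.
  by rewrite -fun_mulsc !mxE -[LHS]/(f _) => h; move: f1; rewrite !mxE h => /esym/eqP; rewrite oner_eq0.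
suff d0 : d = 0 by rewrite -dc d0 matcoef0.
rewrite -pd; apply/matrixP => i j.
have : fixA u (d *m delta_mx j 0).
  by rewrite /fixA /= scM mulmxA; apply: mxinAM => //; apply: mxinA_sc.
by move=> /pW; rewrite mulmxA -!colE => /matrixP/(_ i 0); rewrite [LHS]mxE [RHS]mxE.
Qed.

Lemma adapted_idem n (u : 'M[H]_n) p : adapted u p -> p *m p = p.
Proof.
move=> [pu pA pW]; apply/matrixP => i j.
have : fixA u (p *m delta_mx j 0).
  by rewrite /fixA /= scM mulmxA; apply: mxinAM => //; apply: mxinA_sc.
by move=> /pW; rewrite mulmxA -!colE => /matrixP/(_ i 0); rewrite [LHS]mxE [RHS]mxE.
Qed.

Lemma matcoef_adapted_inA n (u : 'M[H]_n) p c : adapted u p -> inA (matcoef u (p *m c)).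
Proof.
move=> [pu pA pW]; rewrite -matcoef_mulr // /matcoef scM -mulmxA pu; apply: mxtrace_inA.
by apply: mxinAM => //; apply: mxinA_sc.
Qed.

Lemma matcoef_inA_fix n (u : 'M[H]_n) p c : unitary_corep u -> adapted u p ->
  inA (matcoef u c) -> matcoef u (p *m c) = matcoef u c.
Proof.
move=> uc ap cA.
apply/esym/eqP; rewrite -subr_eq0 -matcoefB; apply/eqP.
apply: (matcoef_inA_null uc ap).
  by rewrite mulmxBr mulmxA (adapted_idem ap) subrr.
rewrite matcoefB; apply: subspaceB => //; first exact: inA_subspace.
exact: matcoef_adapted_inA.
Qed.

Lemma adapted_dsum n m (u : 'M[H]_n) (v : 'M[H]_m) p q : adapted u p -> adapted v q ->
  adapted (block_mx u 0 0 v) (block_mx p 0 0 q).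
Proof.
move=> [pu pA pW] [qv qA qW].
have scb k l (w1 : 'M[C]_(n, k)) (w2 : 'M[C]_(m, l)) :
    sc H (block_mx w1 0 0 w2) = block_mx (sc H w1) 0 0 (sc H w2).
  by rewrite /sc map_block_mx !map_mx0.
split.
- by rewrite scb !mulmx_block pu qv !(mulmx0, mul0mx, addr0, add0r).
- rewrite scb mulmx_block !(mulmx0, mul0mx, addr0, add0r) => i j.
  have A0 : inA 0 by case: inA_subspace.
  case: (split_ordP i) => i' ->; case: (split_ordP j) => j' ->;
  by rewrite ?(block_mxEul, block_mxEur, block_mxEdl, block_mxEdr) // mxE.
move=> w; rewrite -[w]vsubmxK /fixA /= /sc map_col_mx mul_block_col !mul0mx addr0 add0r.
move=> hw; rewrite mul_block_col !mul0mx addr0 add0r pW ?qW // => i j.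
- by have := hw (rshift _ i) j; rewrite col_mxEd.
- by have := hw (lshift _ i) j; rewrite col_mxEu.
Qed.

Lemma mxtrace_scC m n (p : 'M[C]_(m, n)) (X : 'M[H]_(n, m)) :
  \tr (sc H p *m X) = \tr (X *m sc H p).
Proof.
rewrite /mxtrace; under eq_bigr do rewrite mul_scE.
by rewrite exchange_big; apply: eq_bigr => i _; rewrite [RHS]mulsc_E.
Qed.

Lemma tscale_sum (I : finType) (F : I -> tensor H H) (a : C) :
  a *: (\sum_i F i) = \sum_i a *: F i.
Proof. exact: scaler_sumr. Qed.

Lemma comul_sum (I : finType) (a : I -> C) (F : I -> H) :
  comul (\sum_i a i *: F i) = \sum_i a i *: comul (F i).
Proof.
rewrite linear_sum; apply: eq_bigr => i _.
exact: linearZ.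
Qed.

Lemma comul_sandwich m n k (s : 'M[C]_(m, n)) (u : 'M[H]_n) (t : 'M[C]_(n, k)) i j :
  corep u -> comul ((sc H s *m u *m sc H t) i j) =
  \sum_l tens ((sc H s *m u) i l) ((u *m sc H t) l j).
Proof.
move=> cu; transitivity (\sum_a \sum_b \sum_l tens (s i b *: u b l) (t a j *: u l a)).
  rewrite mulsc_E comul_sum; apply: eq_bigr => a _.
  rewrite mul_scE comul_sum tscale_sum; apply: eq_bigr => b _.
  rewrite cu !tscale_sum; apply: eq_bigr => l _.
  by rewrite -tensZC -!scale_tens scalerA mulrC -scalerA.
rewrite exchange_big /=; under eq_bigr do rewrite exchange_big /=.
rewrite exchange_big; apply: eq_bigr => l _ /=.
rewrite mul_scE mulsc_E.
pose f := fun x => @tens C H H x (\sum_a t a j *: u l a).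
have -> : tens (\sum_b s i b *: u b l) (\sum_a t a j *: u l a)
    = \sum_b f (s i b *: u b l).
  by apply: (big_morph f) => [x y|]; rewrite /f ?tensDl ?tens0l.
apply: eq_bigr => b _; rewrite /f.
by apply/esym/(big_morph (fun y => tens (s i b *: u b l) y)) => [x y|]; rewrite ?tensDr ?tens0r.
Qed.

Lemma tens_mid m n k l (X : 'M[H]_(m, n)) (p : 'M[C]_(n, k)) (Y : 'M[H]_(k, l)) i j :
  \sum_a @tens C H H (X i a) ((sc H p *m Y) a j) =
  \sum_a tens ((X *m sc H p) i a) (Y a j).
Proof.
transitivity (\sum_a \sum_b tens (X i a) (p a b *: Y b j)).
  apply: eq_bigr => a _; rewrite mul_scE.
  by apply: (big_morph (fun y => tens (X i a) y)) => [x y|]; rewrite ?tensDr ?tens0r.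
rewrite exchange_big; apply: eq_bigr => b _ /=; rewrite mulsc_E.
pose f x := @tens C H H x (Y b j).
rewrite -[RHS]/(f _) (big_morph f (id1 := 0) (op1 := +%R)); rewrite /f.
- by apply: eq_bigr => a _; rewrite tensZC.
- by move=> x y; rewrite tensDl.
- by rewrite tens0l.
Qed.

(** Restriction of [u] to the invariant subspace that is the range of [J]. *)
Lemma compression n k (u : 'M[H]_n) (J : 'M[C]_(n, k)) : unitary_corep u ->
  J^*t *m J = 1%:M -> sc H (J *m J^*t) *m u = u *m sc H (J *m J^*t) ->
  let b := sc H J^*t *m u *m sc H J in unitary_corep b /\ u *m sc H J = sc H J *m b.
Proof.
move=> uc JJ pu b; have [cu eu uu u'u] := unitaryP uc.
have uJ : u *m sc H J = sc H J *m b.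
  by rewrite /b !mulmxA -scM pu scM -!mulmxA -scM JJ sc1 mulmx1.
have adjb : adj b = sc H J^*t *m adj u *m sc H J.
  by rewrite /b !adjM !adj_sc conjtrK mulmxA.
have Ju : sc H J^*t *m u = b *m sc H J^*t.
  rewrite -[LHS]mul1mx -sc1 -JJ scM -mulmxA [sc H J *m _]mulmxA -scM pu.
  by rewrite scM /b !mulmxA.
split=> //; split.
- move=> i j; rewrite [in LHS]/b comul_sandwich // uJ tens_mid.
  by [].
- move=> i j; have : map_mx eps b = 1%:M.
    by rewrite /b fun_mulsc fun_scmul eps_unitary // mulmx1.
  by move=> /matrixP/(_ i j); rewrite [LHS]mxE [RHS]mxE.
- rewrite -/(adj b) adjb !mulmxA -Ju -!mulmxA [u *m (adj u *m _)]mulmxA uu.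
  by rewrite mul1mx -scM JJ sc1.
- by rewrite -/(adj b) adjb -!mulmxA -uJ [adj u *m _]mulmxA u'u mul1mx -scM JJ sc1.
Qed.

End Subalgebra.

(** * The conditional expectation onto a Hopf star-subalgebra *)
Section Expectation.
Variables (R : realType) (H : hopfStarAlg R) (A : hopfStarSubalg H).
Local Notation C := R[i].
Local Notation iA := (incl A).
Hypothesis Hc : compact_hopf H.

(** The expectation is introduced as a relation because its value is computed from
a presentation of [x] as a coefficient; [expectation_graph_fun] says that the
presentation does not matter. *)
Definition expectation_graph (x : H) (a : A) : Prop :=
  exists n (u : 'M[H]_n) p c, [/\ unitary_corep u, adapted A u p,
    x = matcoef u c & iA a = matcoef u (p *m c)].

Lemma expectation_graph_total x : exists a, expectation_graph x a.
Proof.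
have [n [u [v [w [uc xE]]]]] := compact_rank1 Hc x.
have [p ap] := adapted_exists A uc.
have [a aE] := matcoef_adapted_inA (w *m v^*t) ap.
by exists a, n, u, p, (w *m v^*t).
Qed.

Lemma expectation_graph_linear k x a y b : expectation_graph x a ->
  expectation_graph y b -> expectation_graph (k *: x + y) (k *: a + b).
Proof.
move=> [n [u [p [c [uc ap -> aE]]]]] [m [v [q [d [vc aq -> bE]]]]].
exists (n + m)%N, (block_mx u 0 0 v), (block_mx p 0 0 q), (block_mx (k *: c) 0 0 d).
split; [exact: unitary_dsum|exact: adapted_dsum| |].
  by rewrite matcoef_dsum block_mxKul block_mxKdr matcoefZ.
rewrite mulmx_block !(mulmx0, mul0mx, addr0, add0r) matcoef_dsum block_mxKul block_mxKdr.
by rewrite -scalemxAr matcoefZ linearP /= aE bE.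
Qed.

Lemma expectation_graph_fun x a b : expectation_graph x a ->
  expectation_graph x b -> a = b.
Proof.
move=> ha hb; have := expectation_graph_linear (-1) hb ha.
rewrite !scaleN1r addNr => -[n [u [p [c [uc ap x0 abE]]]]].
apply/eqP; rewrite -subr_eq0 -(inj_eq (@incl_inj _ _ A)) linear0.
rewrite addrC abE (matcoef_inA_fix uc ap) -?x0 //.
by case: (inA_subspace A).
Qed.

Definition expectation x : A := projT1 (cid (expectation_graph_total x)).
Local Notation E := expectation.

Lemma expectationP x : expectation_graph x (E x).
Proof. by rewrite /expectation; case: cid. Qed.

Lemma expectation_linear : linear E.
Proof.
move=> a x y; apply: (expectation_graph_fun (expectationP _)).
by apply: expectation_graph_linear; apply: expectationP.
Qed.
HB.instance Definition _ := GRing.isLinear.Build C H A _ E expectation_linear.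

(** The expectation regarded as an idempotent of [H]. *)
Definition expectH : H -> H := iA \o E.
HB.instance Definition _ := GRing.Linear.on expectH.

Lemma expectHP a x y : expectH (a *: x + y) = a *: expectH x + expectH y. Proof. exact: linearP. Qed.
Lemma expectHD x y : expectH (x + y) = expectH x + expectH y. Proof. exact: linearD. Qed.
Lemma expectHZ a x : expectH (a *: x) = a *: expectH x. Proof. exact: linearZ. Qed.
Lemma expectH0 : expectH 0 = 0. Proof. exact: linear0. Qed.
Lemma expectH_sum I (r : seq I) (P : pred I) F :
  expectH (\sum_(i <- r | P i) F i) = \sum_(i <- r | P i) expectH (F i).
Proof. exact: linear_sum. Qed.

Lemma expectH_inA x : inA A (expectH x). Proof. by exists (E x). Qed.

Lemma expectH_matcoef n (u : 'M[H]_n) p c : unitary_corep u -> adapted A u p ->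
  expectH (matcoef u c) = matcoef u (p *m c).
Proof.
move=> uc ap; have [a aE] := matcoef_adapted_inA c ap.
rewrite -aE /expectH /=; congr (iA _); apply: (expectation_graph_fun (expectationP _)).
by exists n, u, p, c.
Qed.

Lemma expectH_corep n (u : 'M[H]_n) p : unitary_corep u -> adapted A u p ->
  map_mx expectH u = u *m sc H p.
Proof.
move=> uc ap; have [pu _ _] := ap; apply/matrixP => i j; rewrite mxE.
rewrite -[u i j](matcoef_delta) (expectH_matcoef _ uc ap) -matcoef_mulr //.
by rewrite /matcoef scM -mulmxA pu -[LHS]/(matcoef _ _) matcoef_delta.
Qed.

Lemma expectation_incl a : E (iA a) = a.
Proof.
have [n [u [v [w [uc xE]]]]] := compact_rank1 Hc (iA a).
have [p ap] := adapted_exists A uc.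
apply: (@incl_inj _ _ A); rewrite -[LHS]/(expectH _) xE (expectH_matcoef _ uc ap).
exact: (matcoef_inA_fix uc ap (ex_intro _ a xE)).
Qed.

Lemma expectH_id x : inA A x -> expectH x = x.
Proof. by move=> [a <-]; rewrite /expectH /= expectation_incl. Qed.

(** The defining formula of the expectation, for matrices indexed by an arbitrary
finite type. *)
Lemma expectH_fin_adapted (T : finType) (t : T -> T -> H) (p : T -> T -> C) a b :
  let M := \matrix_(i, j < #|T|) t (enum_val i) (enum_val j) in
  unitary_corep M ->
  (forall a b, \sum_c p a c *: t c b = \sum_c p c b *: t a c) ->
  (forall a b, inA A (\sum_c p c b *: t a c)) ->
  (forall w : T -> C, (forall a, inA A (\sum_c w c *: t a c)) ->
     forall a, \sum_c p a c * w c = w a) ->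
  expectH (t a b) = \sum_c p c b *: t a c.
Proof.
move=> M Mc pt tA pW; pose P := \matrix_(i, j < #|T|) p (enum_val i) (enum_val j).
have MP i j : (M *m sc H P) i j = \sum_c p c (enum_val j) *: t (enum_val i) c.
  by rewrite mulsc_E [RHS]sum_enum_val; apply: eq_bigr => l _; rewrite !mxE.
have ap : adapted A M P.
  split.
  - apply/matrixP => i j; rewrite MP -pt mul_scE [RHS]sum_enum_val.
    by apply: eq_bigr => l _; rewrite !mxE.
  - by move=> i j; rewrite MP; apply: tA.
  - move=> w hw; apply/matrixP => i o; rewrite ord1.
    rewrite -[i in RHS]enum_valK -(pW (fun c => w (enum_rank c) 0)).
      rewrite mxE [RHS]sum_enum_val; apply: eq_bigr => l _.
      by rewrite mxE enum_valK.
    move=> c; have := hw (enum_rank c) 0; rewrite mulsc_E [X in _ -> inA A X]sum_enum_val.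
    congr (inA A _); apply: eq_bigr => l _.
    by rewrite !mxE enum_rankK enum_valK.
have /matrixP/(_ (enum_rank a) (enum_rank b)) := expectH_corep Mc ap.
by rewrite MP !mxE !enum_rankK.
Qed.

(** If [b] has entries in [A], multiplication by the adjoint of [b] shows that a
vector lies in [fixA] of the tensor product of [b] and [u] exactly when its
components lie in [fixA u]. So the projection adapted to the tensor product is
the identity tensor [p]. *)
Lemma expectH_mul_corep n m (b : 'M[H]_n) (u : 'M[H]_m) i j k l : unitary_corep b ->
  mxinA A b -> unitary_corep u -> expectH (b i j * u k l) = b i j * expectH (u k l).
Proof.
move=> bc bA uc; have [p ap] := adapted_exists A uc; have [pu pA pW] := ap.
have uE : expectH (u k l) = \sum_c p c l *: u k c.
  by have /matrixP/(_ k l) := expectH_corep uc ap; rewrite mulsc_E mxE.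
pose q (x y : 'I_n * 'I_m) := (x.1 == y.1)%:R * p x.2 y.2.
have sumq (F : 'I_n * 'I_m -> H) x :
    \sum_c q c x *: F c = \sum_c p c x.2 *: F (x.1, c).
  rewrite [LHS]sum_pair.
  rewrite (bigD1 x.1) //= [X in _ + X]big1 ?addr0 => [|a ax].
    by apply: eq_bigr => c _; rewrite /q /= eqxx mul1r.
  by apply: big1 => c _; rewrite /q /= (negPf ax) mul0r scale0r.
have -> : b i j * u k l = tprod b u (i, k) (j, l) by [].
rewrite (@expectH_fin_adapted _ _ q).
- rewrite sumq uE mulr_sumr; apply: eq_bigr => c _.
  by rewrite /tprod /= -scalerAr.
- exact: unitary_tprod.
- move=> [x1 x2] [y1 y2]; rewrite sumq /=.
  transitivity (b x1 y1 * (\sum_c p x2 c *: u c y2)).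
    rewrite [LHS]sum_pair.
    rewrite (bigD1 x1) //= [X in _ + X]big1 ?addr0 => [|a ax].
      rewrite mulr_sumr; apply: eq_bigr => c _.
      by rewrite /q /tprod /= eqxx mul1r scalerAr.
    by apply: big1 => c _; rewrite /q /= eq_sym (negPf ax) mul0r scale0r.
  rewrite -mul_scE pu mulsc_E mulr_sumr; apply: eq_bigr => c _.
  by rewrite /tprod /= scalerAr.
- move=> [x1 x2] [y1 y2]; rewrite sumq /=.
  have -> : \sum_c p c y2 *: tprod b u (x1, x2) (y1, c) = b x1 y1 * (u *m sc H p) x2 y2.
    by rewrite mulsc_E mulr_sumr; apply: eq_bigr => c _; rewrite /tprod /= scalerAr.
  by apply: inAM.
- move=> w hw [x1 x2].
  rewrite [LHS]sum_pair.
  rewrite (bigD1 x1) //= [X in _ + X]big1 ?addr0 => [|a ax]; last first.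
    by apply: big1 => c _; rewrite /q /= eq_sym (negPf ax) !mul0r.
  have hx : fixA A u (\col_c w (x1, c)).
    move=> y o; rewrite mulsc_E.
    have -> : \sum_c (\col_c w (x1, c)) c o *: u y c =
       \sum_d star (b d x1) * \sum_c w c *: tprod b u (d, y) c.
      have [_ _ _ b'b] := unitaryP bc.
      have bb a : \sum_d star (b d x1) * b d a = (x1 == a)%:R.
        have /matrixP/(_ x1 a) := b'b; rewrite !mxE => <-.
        by apply: eq_bigr => d _; rewrite adjE.
      transitivity (\sum_a (\sum_d star (b d x1) * b d a) * \sum_c w (a, c) *: u y c).
        rewrite (bigD1 x1) //= [X in _ + X]big1 ?addr0 => [|a ax].
          by rewrite bb eqxx mul1r; apply: eq_bigr => c _; rewrite mxE.
        by rewrite bb eq_sym (negPf ax) mul0r.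
      under eq_bigr do rewrite mulr_suml.
      rewrite exchange_big; apply: eq_bigr => d _ /=.
      rewrite [X in _ * X]sum_pair mulr_sumr.
      apply: eq_bigr => a _; rewrite -mulrA; congr (_ * _).
      rewrite mulr_sumr; apply: eq_bigr => c _.
      by rewrite /tprod /= scalerAr.
    apply: subspace_sum; first exact: inA_subspace.
    by move=> d _; apply: inAM; [apply: inA_star|].
  have /matrixP/(_ x2 0) := pW _ hx; rewrite !mxE => <-.
  by apply: eq_bigr => c _; rewrite /q /= eqxx mul1r mxE.
Qed.

(** An element of [A] is a coefficient of some [u] over [H]; it is already a
coefficient of the compression of [u] to [fixA u], whose entries lie in [A]. *)
Lemma incl_span (P : H -> Prop) : subspace P ->
  (forall k (b : 'M[H]_k), unitary_corep b -> mxinA A b -> forall i j, P (b i j)) ->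
  forall a, P (iA a).
Proof.
move=> sP Pb a; have [n [u [v [w [uc xE]]]]] := compact_rank1 Hc (iA a).
have [k [J [JJ ap uJ]]] := adapted_isometry A uc; have [pu _ _] := ap.
have [bc bE] := compression uc JJ pu.
set b := _ *m _ in bc bE.
have bA : mxinA A b.
  by rewrite /b -mulmxA; apply: mxinAM => //; apply: mxinA_sc.
have -> : iA a = matcoef b (J^*t *m (w *m v^*t) *m J).
  rewrite xE -(matcoef_inA_fix uc ap (ex_intro _ a xE)).
  rewrite /matcoef -mulmxA scM -mulmxA mxtrace_scC -mulmxA bE mulmxA -scM.
  by [].
rewrite matcoefE; apply: subspace_sum => // i _; apply: subspace_sum => // j _.
by apply: subspaceZ => //; apply: Pb.
Qed.

Lemma expectH_mull a x : inA A a -> expectH (a * x) = a * expectH x.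
Proof.
move=> [{}a <-]; move: a x.
apply: (incl_span (P := fun a => forall x, expectH (a * x) = a * expectH x)).
  split=> [x|k a b ha hb x]; first by rewrite !mul0r expectH0.
  by rewrite !mulrDl -!scalerAl expectHP ha hb.
move=> k b bc bA i j; apply: (matcoef_ind Hc) => [|c x y hx hy|n u uc k' l].
- by rewrite mulr0 expectH0 mulr0.
- by rewrite mulrDr -scalerAr !expectHP hx hy mulrDr -scalerAr.
- exact: expectH_mul_corep.
Qed.

Definition eps_expect (x : H) : C := eps (expectH x).
Lemma eps_expect_scalar : scalar eps_expect.
Proof. by move=> a x y; rewrite /eps_expect !linearP. Qed.
HB.instance Definition _ := GRing.isLinear.Build C H C _ eps_expect eps_expect_scalar.

(** Right colinearity of the expectation. *)
Lemma expectH_slice x : expectH x = slice_l eps_expect (comul x).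
Proof.
move: x; apply: (matcoef_ind Hc) => [|a x y hx hy|n u uc i j].
- by rewrite !linear0.
- by rewrite expectHP hx hy !linearP.
have [p ap] := adapted_exists A uc; have [pu _ _] := ap.
have [cu _ _ _] := unitaryP uc.
have uE := expectH_corep uc ap.
rewrite slice_l_corep //; have /matrixP/(_ i j) := uE; rewrite mxE -pu mul_scE => ->.
apply: eq_bigr => k _; congr (_ *: _).
have /(congr1 (map_mx eps)) := uE; rewrite fun_mulsc (eps_unitary uc) mul1mx.
by move=> /matrixP/(_ i k); rewrite !mxE => <-.
Qed.

(** The conjugate of a unitary corepresentation need not be unitary, so [star]
cannot be compared with the defining formula. Instead, the entries of
[v = u (1 - p)] span a subcoalgebra. By colinearity the star of the expectation
of [star (v i j)] lies both in that subcoalgebra, on which the expectation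
vanishes, and in [A], where it is the identity; so it is zero. *)
Lemma expectH_star x : expectH (star x) = star (expectH x).
Proof.
move: x; apply: (matcoef_ind Hc) => [|a x y hx hy|n u uc i j].
- by rewrite expectH0 !star0 expectH0.
- by rewrite starD starZ !expectHP hx hy starD starZ.
have [p ap] := adapted_exists A uc; have [pu pA _] := ap.
have [cu _ _ _] := unitaryP uc.
have pp := adapted_idem ap.
have uE := expectH_corep uc ap.
pose q := 1%:M - p; pose v := u *m sc H q.
have qE : sc H q = 1%:M - sc H p by rewrite /q /sc map_mxB map_mx1.
have qq : q *m q = q by rewrite /q mulmxBr !mulmxBl !mul1mx !mulmx1 pp subrr subr0.
have qu : sc H q *m u = u *m sc H q by rewrite qE mulmxBl mulmxBr mul1mx mulmx1 pu.
have vE : map_mx expectH v = 0.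
  apply/matrixP => k l; rewrite mxE mulsc_E expectH_sum mxE.
  transitivity ((map_mx expectH u *m sc H q) k l).
    by rewrite mulsc_E; apply: eq_bigr => r _; rewrite expectHZ [map_mx _ _ _ _]mxE.
  by rewrite uE -mulmxA -scM /q mulmxBr mulmx1 pp subrr /sc map_mx0 mulmx0 mxE.
have vc k l : comul (v k l) = \sum_r tens (v k r) (v r l).
  transitivity (comul ((sc H 1%:M *m u *m sc H q) k l)); first by rewrite sc1 mul1mx.
  rewrite comul_sandwich // sc1 mul1mx.
  have -> : u *m sc H q = sc H q *m v by rewrite /v mulmxA qu -mulmxA -scM qq.
  by rewrite tens_mid.
have svc := comul_star_corep i j vc.
have sv0 : expectH (star (v i j)) = 0.
  have e : expectH (star (v i j)) = \sum_r eps_expect (star (v i r)) *: star (v r j).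
    rewrite expectH_slice svc linear_sum; apply: eq_bigr => r _.
    by rewrite [LHS]slice_l_tens.
  rewrite -[LHS]star_invol -[RHS]star0; congr star.
  rewrite -(expectH_id (inA_star (expectH_inA (star (v i j))))) e star_sum expectH_sum.
  apply: big1 => r _; rewrite starZ star_invol expectHZ.
  by have /matrixP/(_ r j) := vE; rewrite !mxE => ->; rewrite scaler0.
have -> : u i j = (u *m sc H p) i j + v i j.
  rewrite /v qE mulmxBr mulmx1 addrC.
  by rewrite [X in X + _]mxE [X in _ + X + _]mxE subrK.
rewrite starD !expectHD sv0 addr0 starD.
have -> : expectH (v i j) = 0.
  by have /matrixP/(_ i j) := vE; rewrite [LHS]mxE [RHS]mxE.
rewrite star0 addr0.
by rewrite (expectH_id (inA_star (pA i j))) (expectH_id (pA i j)).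
Qed.

Lemma expectH_mulr a x : inA A a -> expectH (x * a) = expectH x * a.
Proof.
move=> aA; rewrite -[LHS]star_invol -expectH_star starM expectH_mull; last exact: inA_star.
by rewrite starM star_invol expectH_star star_invol.
Qed.

Lemma expectation_star x : E (star x) = star (E x).
Proof. by apply: (@incl_inj _ _ A); rewrite -incl_star; apply: expectH_star. Qed.

Lemma expectation_mull a x : E (iA a * x) = a * E x.
Proof. by apply: (@incl_inj _ _ A); rewrite rmorphM; apply: expectH_mull; exists a. Qed.

Lemma expectation_mulr a x : E (x * iA a) = E x * a.
Proof. by apply: (@incl_inj _ _ A); rewrite rmorphM; apply: expectH_mulr; exists a. Qed.

Lemma expectation_antipode x : E (antipode x) = antipode (E x).
Proof.
apply: (@incl_inj _ _ A); rewrite -incl_antipode.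
move: x; apply: (matcoef_ind Hc) => [|a x y hx hy|n u uc i j].
- by rewrite !linear0.
- rewrite [antipode (_ + _)]linearP [E (_ + _)]linearP [iA (_ + _)]linearP /= hx.
  rewrite hy.
  by rewrite -[RHS]/(antipode (expectH (a *: x + y))) linearP [RHS]linearP.
have [k [J [JJ ap _]]] := adapted_isometry A uc; set p := J *m _ in ap.
have [pu _ _] := ap.
have ph : p^*t = p by rewrite /p conjtrM conjtrK.
have Su k' l : antipode (u k' l) = star (u l k').
  by have /matrixP/(_ k' l) := antipode_corep uc; rewrite mxE adjE.
have uE k' l : expectH (u k' l) = (u *m sc H p) k' l.
  by have /matrixP/(_ k' l) := expectH_corep uc ap; rewrite mxE.
rewrite -[LHS]/(expectH _) -[iA _]/(expectH _) Su expectH_star !uE -pu.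
rewrite mul_scE star_sum pu mulsc_E linear_sum; apply: eq_bigr => l _.
rewrite linearZ starZ Su; congr (_ *: _).
by have /matrixP/(_ l j) := ph; rewrite !mxE.
Qed.

(** The comultiplication of [A] is recovered from that of [H] by applying the
expectation, which is a left inverse of the inclusion. *)
Lemma comul_expectation x : comul (E x) = tmap E E (comul x).
Proof.
have h a : comul a = tmap E E (comul (iA a)).
  rewrite incl_comul; elim/tensor_ind: (comul a) => [|s t hs ht|y z].
  - by rewrite !linear0.
  - by rewrite !linearD /= -hs -ht.
  - by rewrite !tmap_tens /= !expectation_incl.
rewrite h; move: x; apply: (matcoef_ind Hc) => [|a x y hx hy|n u uc i j].
- by rewrite !linear0.
- by rewrite !linearP /= hx hy.
have [p ap] := adapted_exists A uc; have [pu pA _] := ap.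
have [cu _ _ _] := unitaryP uc.
rewrite -[iA _]/(expectH _).
have uE k l : expectH (u k l) = (u *m sc H p) k l.
  by have /matrixP/(_ k l) := expectH_corep uc ap; rewrite mxE.
rewrite uE cu.
have -> : comul ((u *m sc H p) i j) = \sum_l tens (u i l) (expectH (u l j)).
  transitivity (comul ((sc H 1%:M *m u *m sc H p) i j)); first by rewrite sc1 mul1mx.
  rewrite comul_sandwich // sc1 mul1mx.
  by apply: eq_bigr => l _; rewrite uE.
rewrite !linear_sum; apply: eq_bigr => l _.
by rewrite [LHS]tmap_tens [RHS]tmap_tens /expectH /= expectation_incl.
Qed.

End Expectation.

(** * An invariant positive functional on matrices *)
Section ConjugateForm.
Variables (R : realType) (H : hopfStarAlg R).
Local Notation C := R[i].
Hypothesis Hc : compact_hopf H.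

Definition pairing n (r T : 'M[C]_n) : C := \sum_k \sum_l T k l * r k l.

(** The conjugate comodule embeds in a multiple of a unitary one. All entries of
the conjugate are coefficients of one unitary [w]; choosing the representing
matrices orthogonal to the kernel of [matcoef w] makes them unique, and then
the comultiplication forces the intertwining relation. *)
Lemma conjugate_embedding n (u : 'M[H]_n) : unitary_corep u ->
  exists N (w : 'M[H]_N) (c : 'I_n -> 'I_n -> 'M[C]_N), unitary_corep w /\
    (forall i j, matcoef w (c i j) = star (u i j)) /\
    forall i j a b, (sc H (c i j) *m w) a b = \sum_k c k j a b *: star (u i k).
Proof.
move=> uc; have [cu _ _ _] := unitaryP uc.
have [N [w [wc hw]]] := compact_family Hc [seq star (u p.1 p.2) | p : 'I_n * 'I_n].
have [cw _ _ _] := unitaryP wc.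
pose K (k : 'M[C]_N) : Prop := matcoef w k = 0.
have sK : subspace K.
  split; first exact: matcoef0.
  by move=> a x y; rewrite /K matcoef_linear => -> ->; rewrite scaler0 addr0.
have Kinv (f : {scalar H}) k : K k -> K (k *m map_mx f w).
  by rewrite /K => wk; rewrite -slice_l_matcoef // wk !linear0.
have ex p : exists c : 'M[C]_N, matcoef w c = star (u p.1 p.2) /\
    forall z, K z -> mxdot z c = 0.
  have [|c0 c0E] := hw (star (u p.1 p.2)).
    by apply/mapP; exists p => //; rewrite mem_enum.
  have [y [Ky yP]] :=
    orthogonal_decomposition (@mxdot_psd _ N N) c0 (@mxdot_definite _ N N) sK.
  by exists (c0 - y); rewrite matcoefB Ky subr0.
have [c cP] := choice ex.
exists N, w, (fun i j => c (i, j)); split=> //; split.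
  by move=> i j; case: (cP (i, j)).
move=> i j a b; apply: functional_ext => f.
rewrite linear_sum.
have cE k l : matcoef w (c (k, l)) = star (u k l) by case: (cP (k, l)).
(* seen through [f], the two sides differ by [d], which lies in [K] and is
   orthogonal to [K] *)
pose d := c (i, j) *m map_mx f w - \sum_k f (star (u i k)) *: c (k, j).
have dK : K d.
  rewrite /K /d matcoefB -slice_l_matcoef // cE comul_star_corep // linear_sum.
  rewrite [matcoef _ _]linear_sum -sumrB big1 // => k _.
  by rewrite [X in X - _]slice_l_tens /= matcoefZ cE subrr.
have dP z : K z -> mxdot z d = 0.
  move=> Kz.
  rewrite /d (psdBr (mxdot_psd _ _ _)) (psd_sumr (mxdot_psd _ _ _)) big1 => [|k _].
    have := (cP (i, j)).2 _ (Kinv (adjoint_functional f) _ Kz).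
    rewrite adjoint_functional_mx // /mxdot conjtrM conjtrK => h.
    by rewrite subr0 mulmxA mxtrace_mulC mulmxA.
  by rewrite (psdZr (mxdot_psd _ _ _)) (cP (k, j)).2 ?mulr0.
have /eqP := mxdot_definite (dP _ dK); rewrite subr_eq0 => /eqP /matrixP /(_ a b).
rewrite -fun_scmul mxE [RHS]summxE => ->.
by apply: eq_bigr => k _; rewrite mxE linearZ /= mulrC.
Qed.

(** The matrix [r] is the Gram matrix of the embedding of
[conjugate_embedding]. It is positive definite, the embedding being injective
by the counit, and it is invariant under the conjugate of [u] since the target
corepresentation is unitary. *)
Lemma conjugate_invariant_form n (u : 'M[H]_n) : unitary_corep u ->
  exists r : 'M[C]_n,
    (forall k l, \sum_i \sum_j r i j *: (star (u k i) * u l j) = (r k l)%:A) /\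
    forall m (S : 'M[C]_(m, n)),
      0 <= pairing r (S^*t *m S) /\ (pairing r (S^*t *m S) = 0 -> S = 0).
Proof.
move=> uc; have [N [w [c [wc [cE cw]]]]] := conjugate_embedding uc.
have [_ eu uu _] := unitaryP uc; have [_ _ ww _] := unitaryP wc.
exists (\matrix_(k, l) \sum_j \sum_a \sum_b c k j a b * (c l j a b)^*); split.
  move=> k l.
  transitivity (\sum_j \sum_a \sum_b (sc H (c k j) *m w) a b * star ((sc H (c l j) *m w) a b)).
    transitivity (\sum_i \sum_i' \sum_j \sum_a \sum_b
       (c i j a b *: star (u k i)) * star (c i' j a b *: star (u l i'))).
      apply: eq_bigr => i _; apply: eq_bigr => i' _; rewrite mxE scaler_suml.
      apply: eq_bigr => j _; rewrite scaler_suml; apply: eq_bigr => a _.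
      rewrite scaler_suml; apply: eq_bigr => b _.
      by rewrite starZ star_invol -scalerAl -scalerAr scalerA.
    rewrite exchange_big /=; under eq_bigr do rewrite exchange_big /=.
    rewrite exchange_big; apply: eq_bigr => j _ /=.
    under eq_bigr do rewrite exchange_big /=.
    rewrite exchange_big; apply: eq_bigr => a _ /=.
    under eq_bigr do rewrite exchange_big /=.
    rewrite exchange_big; apply: eq_bigr => b _ /=.
    rewrite !cw star_sum mulr_sumr; apply: eq_bigr => i' _.
    by rewrite mulr_suml.
  rewrite mxE scaler_suml; apply: eq_bigr => j _.
  rewrite scaler_suml; apply: eq_bigr => a _.
  have : ((sc H (c k j) *m w) *m adj (sc H (c l j) *m w)) a a
       = (sc H (c k j *m (c l j)^*t)) a a.
    by rewrite adjM adj_sc !mulmxA -[_ *m w *m _]mulmxA ww mulmx1 -scM.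
  rewrite scE mxE [in X in _ = X]mxE => h.
  transitivity (\sum_b (sc H (c k j) *m w) a b * adj (sc H (c l j) *m w) b a).
    by apply: eq_bigr => b _; rewrite adjE.
  by rewrite h; congr (_ *: _); apply: eq_bigr => b _; rewrite !mxE.
move=> m S.
pose z s j a b := \sum_k (S s k)^* * c k j a b.
have zE : pairing (\matrix_(k, l) \sum_j \sum_a \sum_b c k j a b * (c l j a b)^*) (S^*t *m S)
   = \sum_s \sum_j \sum_a \sum_b z s j a b * (z s j a b)^*.
  transitivity (\sum_k \sum_l \sum_s \sum_j \sum_a \sum_b
     ((S s k)^* * c k j a b) * ((S s l)^* * c l j a b)^*).
    apply: eq_bigr => k _; apply: eq_bigr => l _; rewrite !mxE mulr_suml.
    apply: eq_bigr => s _; rewrite mulr_sumr; apply: eq_bigr => j _.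
    rewrite mulr_sumr; apply: eq_bigr => a _.
    rewrite mulr_sumr; apply: eq_bigr => b _.
    by rewrite !mxE rmorphM /= conjCK mulrACA.
  under eq_bigr do rewrite exchange_big /=.
  rewrite exchange_big; apply: eq_bigr => s _ /=.
  under eq_bigr do rewrite exchange_big /=.
  rewrite exchange_big; apply: eq_bigr => j _ /=.
  under eq_bigr do rewrite exchange_big /=.
  rewrite exchange_big; apply: eq_bigr => a _ /=.
  under eq_bigr do rewrite exchange_big /=.
  rewrite exchange_big; apply: eq_bigr => b _ /=.
  rewrite /z rmorph_sum mulr_suml; apply: eq_bigr => k _.
  by rewrite mulr_sumr.
have z0 s j a b : 0 <= z s j a b * (z s j a b)^* by apply: mul_conjC_ge0.
rewrite zE; split; first by do 4! apply: sumr_ge0 => ? _.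
move=> /eqP; rewrite psumr_eq0; last by move=> ? _; do 3! apply: sumr_ge0 => ? _.
move=> /allP h; apply/matrixP => s i; rewrite mxE.
have {h} := h s (mem_index_enum _).
rewrite psumr_eq0; last by move=> ? _; do 2! apply: sumr_ge0 => ? _.
move=> /allP h.
have zz j a b : z s j a b = 0.
  have {h} := h j (mem_index_enum _).
  rewrite psumr_eq0; last by move=> ? _; apply: sumr_ge0 => ? _.
  move=> /allP /(_ a (mem_index_enum _)).
  rewrite psumr_eq0 // => /allP /(_ b (mem_index_enum _)).
  by rewrite /= mul_conjC_eq0 => /eqP.
have : \sum_k (S s k)^* *: star (u k i) = 0.
  transitivity (matcoef w (\sum_k (S s k)^* *: c k i)).
    by rewrite linear_sum; apply: eq_bigr => k _; rewrite linearZ /= cE.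
  rewrite (_ : \sum_k _ = 0) ?matcoef0 //; apply/matrixP => a b.
  by rewrite summxE [RHS]mxE -[RHS](zz i a b); apply: eq_bigr => k _; rewrite mxE.
move=> /(congr1 eps); rewrite linear0 linear_sum (bigD1 i) //= big1 => [|k ki].
  rewrite linearZ /= eps_star // [eps _]eu eqxx rmorph1 mulr1 addr0.
  by move=> /(congr1 Num.conj); rewrite conjCK conjC0.
by rewrite linearZ /= eps_star // [eps _]eu (negPf ki) conjC0 mulr0.
Qed.

End ConjugateForm.

(** * Positivity and nondegeneracy of the expectation *)
Section Positivity.
Variables (R : realType) (H : hopfStarAlg R) (A : hopfStarSubalg H).
Local Notation C := R[i].
Local Notation iA := (incl A).
Hypothesis Hc : compact_hopf H.
Local Notation E := (@expectation R H A Hc).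
Local Notation expectH := (@expectH R H A Hc).
Local Notation eps_expect := (@eps_expect R H A Hc).

Lemma map_expectH_mull m n k (X : 'M[H]_(m, n)) (Y : 'M_(n, k)) : mxinA A X ->
  map_mx expectH (X *m Y) = X *m map_mx expectH Y.
Proof.
move=> XA; apply/matrixP => i j; rewrite !mxE expectH_sum; apply: eq_bigr => l _.
by rewrite expectH_mull // mxE.
Qed.

Lemma map_expectH_mulr m n k (X : 'M[H]_(m, n)) (Y : 'M_(n, k)) : mxinA A Y ->
  map_mx expectH (X *m Y) = map_mx expectH X *m Y.
Proof.
move=> XA; apply/matrixP => i j; rewrite !mxE expectH_sum; apply: eq_bigr => l _.
by rewrite expectH_mulr // mxE.
Qed.

Lemma map_expectH_adj m n (X : 'M[H]_(m, n)) : map_mx expectH (adj X) = adj (map_mx expectH X).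
Proof. by apply/matrixP => i j; rewrite mxE !adjE expectH_star mxE. Qed.

Section Corep.
Variables (n : nat) (u : 'M[H]_n).
Hypothesis uc : unitary_corep u.

(** The coaction of [H] on matrices by conjugation with [u]; it is multiplicative
and compatible with adjoints. *)
Definition mconj (T : 'M[C]_n) : 'M[H]_n := adj u *m sc H T *m u.

Lemma mconjM S T : mconj (S *m T) = mconj S *m mconj T.
Proof.
have [_ _ uu _] := unitaryP uc.
by rewrite /mconj scM !mulmxA -[_ *m u *m adj u]mulmxA uu mulmx1.
Qed.

Lemma mconj1 : mconj 1%:M = 1%:M.
Proof. by have [_ _ _ u'u] := unitaryP uc; rewrite /mconj sc1 mulmx1. Qed.

Lemma mconjE T i j : mconj T i j = \sum_k \sum_l T k l *: (star (u k i) * u l j).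
Proof.
rewrite /mconj -mulmxA mxE; apply: eq_bigr => k _.
rewrite adjE mul_scE mulr_sumr; apply: eq_bigr => l _.
by rewrite -scalerAr.
Qed.

Lemma mconjP a S T i j :
  mconj (a *: S + T) i j = a *: mconj S i j + mconj T i j.
Proof.
rewrite !mconjE scaler_sumr -big_split.
apply: eq_bigr => k _ /=; rewrite scaler_sumr -big_split; apply: eq_bigr => l _ /=.
by rewrite !mxE scalerDl scalerA.
Qed.

Lemma mconj_adj T : adj (mconj T) = mconj T^*t.
Proof. by rewrite /mconj !adjM adj_sc adjK mulmxA. Qed.

Lemma mconj_eps T : map_mx eps (mconj T) = T.
Proof.
have [_ _ _ u'u] := unitaryP uc.
have eu := eps_unitary uc.
rewrite /mconj !map_mxM /= eu mulmx1.
have := congr1 (map_mx eps) u'u; rewrite map_mxM /= eu mulmx1 map_mx1 => ->.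
rewrite mul1mx; apply/matrixP => i j; rewrite !mxE linearZ /= rmorph1.
exact: mulr1.
Qed.

(** The matrix form of the expectation on the coaction [mconj]: a projection onto
the algebra of those [T] for which [mconj T] has entries in [A]. *)
Definition proj_inv (T : 'M[C]_n) : 'M[C]_n := map_mx eps_expect (mconj T).

Lemma expectH_mconj T : map_mx expectH (mconj T) = mconj (proj_inv T).
Proof.
have [cu _ _ _] := unitaryP uc.
have sl k l i j : expectH (star (u k i) * u l j) =
    \sum_a \sum_b eps_expect (star (u k a) * u l b) *: (star (u a i) * u b j).
  rewrite expectH_slice comulM comul_star_corep // cu mulr_suml linear_sum.
  apply: eq_bigr => a _; rewrite mulr_sumr linear_sum; apply: eq_bigr => b _.
  by rewrite mul_tens [LHS]slice_l_tens.
apply/matrixP => i j; rewrite mxE !mconjE expectH_sum.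
transitivity (\sum_k \sum_l \sum_a \sum_b
   (T k l * eps_expect (star (u k a) * u l b)) *: (star (u a i) * u b j)).
  apply: eq_bigr => k _; rewrite expectH_sum; apply: eq_bigr => l _.
  rewrite expectHZ sl scaler_sumr; apply: eq_bigr => a _.
  by rewrite scaler_sumr; apply: eq_bigr => b _; rewrite scalerA.
under eq_bigr do rewrite exchange_big /=.
rewrite exchange_big; apply: eq_bigr => a _ /=.
under eq_bigr do rewrite exchange_big /=.
rewrite exchange_big; apply: eq_bigr => b _ /=.
rewrite mxE mconjE linear_sum scaler_suml; apply: eq_bigr => k _.
rewrite linear_sum scaler_suml; apply: eq_bigr => l _.
by rewrite linearZ.
Qed.

Lemma proj_invP a S T : proj_inv (a *: S + T) = a *: proj_inv S + proj_inv T.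
Proof.
by apply/matrixP => i j; rewrite [LHS]mxE mconjP linearP !mxE.
Qed.

Lemma mconj_inj S T : mconj S = mconj T -> S = T.
Proof. by move=> h; rewrite -[S]mconj_eps h mconj_eps. Qed.

Lemma proj_inv_adj T : proj_inv T^*t = (proj_inv T)^*t.
Proof. by apply: mconj_inj; rewrite -expectH_mconj -!mconj_adj map_expectH_adj expectH_mconj. Qed.

Lemma proj_inv_inA T : mxinA A (mconj (proj_inv T)).
Proof. by rewrite -expectH_mconj => i j; rewrite mxE; apply: expectH_inA. Qed.

Lemma proj_inv_mul S T U : mxinA A (mconj S) -> mxinA A (mconj U) ->
  proj_inv (S *m T *m U) = S *m proj_inv T *m U.
Proof.
move=> SA UA; apply: mconj_inj; rewrite -expectH_mconj !mconjM.
by rewrite map_expectH_mulr // map_expectH_mull // expectH_mconj.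
Qed.

(** Contracting [mconj T] with the invariant matrix [r] yields a scalar, on which
the expectation is the identity. *)
Lemma pairing_proj_inv (r T : 'M[C]_n) :
  (forall k l, \sum_i \sum_j r i j *: (star (u k i) * u l j) = (r k l)%:A) ->
  pairing r (proj_inv T) = pairing r T.
Proof.
move=> rP.
have h S : \sum_i \sum_j r i j *: mconj S i j = (pairing r S)%:A.
  transitivity (\sum_i \sum_j \sum_k \sum_l (r i j * S k l) *: (star (u k i) * u l j)).
    apply: eq_bigr => i _; apply: eq_bigr => j _; rewrite mconjE scaler_sumr.
    apply: eq_bigr => k _; rewrite scaler_sumr; apply: eq_bigr => l _.
    by rewrite scalerA.
  under eq_bigr do rewrite exchange_big /=.
  rewrite exchange_big /pairing scaler_suml; apply: eq_bigr => k _ /=.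
  under eq_bigr do rewrite exchange_big /=.
  rewrite exchange_big scaler_suml; apply: eq_bigr => l _ /=.
  rewrite -scalerA -rP scaler_sumr; apply: eq_bigr => i _.
  by rewrite scaler_sumr; apply: eq_bigr => j _; rewrite scalerA mulrC.
have /(congr1 eps) : (pairing r (proj_inv T))%:A = (pairing r T)%:A :> H.
  have A1 := inA1 A.
  rewrite -h -[RHS](@expectH_id _ _ A Hc); last by apply: subspaceZ => //; apply: inA_subspace.
  rewrite -h expectH_sum; apply: eq_bigr => i _; rewrite expectH_sum; apply: eq_bigr => j _.
  by rewrite expectHZ -expectH_mconj [map_mx _ _ _ _]mxE.
by rewrite !linearZ /= rmorph1 !mulr1.
Qed.
End Corep.

Lemma matcoef_rank1 n (u : 'M[H]_n) (v w : 'cV[C]_n) :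
  matcoef u (w *m v^*t) = (sc H v^*t *m u *m sc H w) 0 0.
Proof.
by rewrite /matcoef scM -mulmxA mxtrace_scC /mxtrace big_ord1.
Qed.

Lemma mxdot_row_null n (k : 'M[C]_n) : k^*t *m k = 0 -> k = 0.
Proof. by move=> h; apply: mxdot_definite; rewrite /mxdot h mxtrace0. Qed.

Lemma pairingN n (r T : 'M[C]_n) : pairing r (- T) = - pairing r T.
Proof.
rewrite /pairing -sumrN; apply: eq_bigr => k _; rewrite -sumrN; apply: eq_bigr => l _.
by rewrite mxE mulNr.
Qed.

(** Write the hermitian matrix [y] that is the image of [v *m v^*t] as
[g g - k k], with [g k = 0]. The invariant positive functional takes a
nonnegative value on [k v v^*t k], hence on its projection
[k y k = - (k k) (k k)]; by faithfulness [k k = 0], and so [k = 0]. *)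
Lemma proj_inv_positive n (u : 'M[H]_n) (v : 'cV[C]_n) : unitary_corep u ->
  exists g, [/\ mxinA A (mconj u g), g^*t = g & proj_inv u (v *m v^*t) = g *m g].
Proof.
move=> uc; set y := proj_inv u _.
have sA := inA_subspace A.
pose D (T : 'M[C]_n) : Prop := mxinA A (mconj u T).
have sD : subspace D.
  split=> [i j|a S T hS hT i j].
    have -> : mconj u 0 = 0 by rewrite /mconj /sc map_mx0 mulmx0 mul0mx.
    by rewrite mxE; case: sA.
  by rewrite mconjP; case: sA => _; apply.
have D1 : D 1%:M by rewrite /D mconj1 // -(sc1 H); apply: mxinA_sc.
have DM S T : D S -> D T -> D (S *m T).
  by move=> hS hT; rewrite /D mconjM //; apply: mxinAM.
have Dy : D y by apply: proj_inv_inA.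
have yh : y^*t = y by rewrite /y -proj_inv_adj // conjtrM conjtrK.
have [g [k [Dg Dk gh kh [gk yE]]]] := hermitian_sqrt_split sD D1 DM Dy yh.
have [r [rP rpos]] := conjugate_invariant_form Hc uc.
have kg : k *m g = 0.
  by rewrite -[LHS]conjtrK conjtrM gh kh gk trmx0 map_mx0.
have kyk : k *m y *m k = - ((k *m k)^*t *m (k *m k)).
  by rewrite yE mulmxBr mulmxBl !mulmxA kg !mul0mx sub0r conjtrM kh ?mulmxA.
have h1 : 0 <= pairing r (k *m y *m k).
  rewrite /y -proj_inv_mul // pairing_proj_inv //.
  have -> : k *m (v *m v^*t) *m k = (v^*t *m k)^*t *m (v^*t *m k).
    by rewrite conjtrM conjtrK kh !mulmxA.
  by case: (rpos _ (v^*t *m k)).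
have [h2 h3] := rpos _ (k *m k).
have kk0 : k *m k = 0.
  apply: h3; apply/eqP; rewrite eq_le h2 andbT -oppr_ge0.
  by rewrite -pairingN -kyk.
have k0 : k = 0 by apply: mxdot_row_null; rewrite kh.
by exists g; split=> //; rewrite yE k0 mulmx0 subr0.
Qed.

(** With [x] the coefficient of [v] and [w] in [u], the element [star x * x] is
[w^*t (mconj (v v^*t)) w], whose expectation is [w^*t (mconj (g g)) w], the
inner square of the column [mconj g w] with entries in [A]. *)
Lemma expectation_positive x : exists m (z : 'I_m -> A),
  E (star x * x) = \sum_i star (z i) * z i.
Proof.
have [n [u [v [w [uc xE]]]]] := compact_rank1 Hc x.
have [g [gA gh yE]] := proj_inv_positive v uc.
pose Z := mconj u g *m sc H w.
have ZA : mxinA A Z by apply: mxinAM => //; apply: mxinA_sc.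
have [z zE] := choice (fun i => ZA i 0).
exists n, z; apply: (@incl_inj _ _ A); rewrite -[LHS]/(expectH _) linear_sum.
have xx : star x * x = (sc H w^*t *m mconj u (v *m v^*t) *m sc H w) 0 0.
  rewrite xE matcoef_rank1 -adjE.
  set X := sc H v^*t *m u *m sc H w.
  have -> : adj X 0 0 * X 0 0 = (adj X *m X) 0 0 by rewrite [RHS]mxE big_ord1.
  by rewrite /X !adjM !adj_sc conjtrK /mconj scM !mulmxA.
have -> : expectH (star x * x) = map_mx expectH (sc H w^*t *m mconj u (v *m v^*t) *m sc H w) 0 0.
  by rewrite xx [RHS]mxE.
rewrite map_expectH_mulr; last exact: mxinA_sc.
rewrite map_expectH_mull; last exact: mxinA_sc.
rewrite expectH_mconj // yE mconjM //.
have -> : sc H w^*t *m (mconj u g *m mconj u g) *m sc H w = adj Z *m Z.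
  by rewrite /Z adjM adj_sc mconj_adj // gh !mulmxA.
rewrite mxE; apply: eq_bigr => i _.
by rewrite adjE -zE rmorphM /= incl_star.
Qed.

(** Let [x] be the coefficient of [v] and [w] in [u]. The hypothesis for [y] the
stars of the entries of [u] says that certain matrices [B k], the projections
of the rank one matrices built on [v], satisfy [B k u w = 0]. The vectors with
this property form an invariant subspace; its projection [p] commutes with
[u], fixes [w], and satisfies [B k p = 0]. Applying the faithful invariant
functional to the projection of [p v v^*t p] gives [v^*t p = 0], whence [x],
the coefficient of [v] and [p w], is zero. *)
Lemma expectation_nondegenerate x : (forall y, E (y * x) = 0) -> x = 0.
Proof.
move=> Ex; have [n [u [v [w [uc xE]]]]] := compact_rank1 Hc x.
have [cu eu uu u'u] := unitaryP uc.
pose B k : 'M[C]_n := proj_inv u (delta_mx k 0 *m v^*t).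
pose Z (z : 'cV[C]_n) : Prop := forall k, sc H (B k) *m u *m sc H z = 0.
have sZ : subspace Z.
  split=> [k|a y z hy hz k]; first by rewrite /sc map_mx0 mulmx0.
  apply/matrixP => i j; rewrite mulsc_E.
  transitivity (a *: (sc H (B k) *m u *m sc H y) i j + (sc H (B k) *m u *m sc H z) i j).
    rewrite !mulsc_E scaler_sumr -big_split; apply: eq_bigr => l _ /=.
    by rewrite !mxE scalerDl scalerA.
  by rewrite hy hz !mxE scaler0 addr0.
have Zinv (f : {scalar H}) z : Z z -> Z (map_mx f u *m z).
  move=> hz k; apply/matrixP => i j; rewrite -mulmxA -slice_r_mulsc //.
  by rewrite mulmxA hz !mxE !linear0.
have Zw : Z w.
  move=> k.
  have e : map_mx expectH (mconj u (delta_mx k 0 *m v^*t) *m sc H w) = 0.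
    apply/matrixP => l o; rewrite ord1 mxE [RHS]mxE.
    have -> : (mconj u (delta_mx k 0 *m v^*t) *m sc H w) l 0 = star (u k l) * x.
      rewrite xE matcoef_rank1 /mconj scM -!mulmxA !mulmxA.
      rewrite -[_ *m u *m _]mulmxA -[_ *m sc H v^*t *m _]mulmxA.
      rewrite mxE big_ord1 !mulmxA; congr (_ * _).
      rewrite mulsc_E (bigD1 k) //= mxE !eqxx scale1r adjE big1 ?addr0 // => r rk.
      by rewrite mxE (negPf rk) scale0r.
    by rewrite /expectH /= Ex linear0.
  (* cancelling the invertible factor [adj u] on the left *)
  move: e; rewrite map_expectH_mulr; last exact: mxinA_sc.
  rewrite expectH_mconj // -/(B k) /mconj => /(congr1 (mulmx u)).
  by rewrite mulmx0 !mulmxA uu mul1mx.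
have [d [J [JJ ZJ pu]]] := invariant_subspace uc sZ Zinv.
set p := J *m J^*t in ZJ pu.
have ph : p^*t = p by rewrite /p conjtrM conjtrK.
have pw : p *m w = w by apply/ZJ.
have pp : p *m p = p by rewrite /p mulmxA -[_ *m J]mulmxA JJ mulmx1.
have mp : mconj u p = sc H p by rewrite /mconj -mulmxA pu mulmxA u'u mul1mx.
have Bp k : B k *m p = 0.
  apply: (mconj_inj uc); rewrite mconjM // mp.
  rewrite {1}/mconj -!mulmxA.
  have -> : sc H (B k) *m (u *m sc H p) = 0.
    apply/matrixP => i j.
    have Zp : Z (p *m delta_mx j 0) by apply/ZJ; rewrite mulmxA pp.
    have /matrixP/(_ i 0) := Zp k; rewrite scM !mulmxA.
    rewrite mulsc_E (bigD1 j) //= big1 ?addr0 => [|l lj]; last by rewrite mxE (negPf lj) scale0r.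
    by rewrite mxE !eqxx scale1r => ->; rewrite !mxE.
  by rewrite mulmx0 /mconj /sc map_mx0 mulmx0 mul0mx.
have pA : mxinA A (mconj u p) by rewrite mp; apply: mxinA_sc.
have A1 : mxinA A (mconj u 1%:M) by rewrite mconj1 // -(sc1 H); apply: mxinA_sc.
have Gp (g : 'cV[C]_n) : proj_inv u (g *m v^*t *m p) = 0.
  rewrite -[g *m _]mul1mx proj_inv_mul // mul1mx.
  have -> : proj_inv u (g *m v^*t) = \sum_k g k 0 *: B k.
    have -> : g *m v^*t = \sum_k g k 0 *: (delta_mx k 0 *m v^*t).
      rewrite {1}[g]matrix_sum_delta mulmx_suml; apply: eq_bigr => k _.
      by rewrite big_ord1 -scalemxAl.
    apply: (big_rec2 (fun S T => proj_inv u S = T)) => [|k S T _ <-].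
      by apply: (mconj_inj uc); rewrite -expectH_mconj // /mconj /sc !(map_mx0, mulmx0, mul0mx).
    by rewrite proj_invP.
  by rewrite mulmx_suml big1 // => k _; rewrite -scalemxAl Bp scaler0.
have [r [rP rpos]] := conjugate_invariant_form Hc uc.
have pv : v^*t *m p = 0.
  have [_ h] := rpos _ (v^*t *m p); apply: h.
  rewrite conjtrM conjtrK ph mulmxA -(pairing_proj_inv uc _ rP) Gp /pairing.
  by rewrite big1 // => k _; rewrite big1 // => l _; rewrite mxE mul0r.
rewrite xE matcoef_rank1 -pw scM -mulmxA [u *m _]mulmxA -pu !mulmxA -scM pv.
by rewrite /sc map_mx0 !mul0mx mxE.
Qed.

End Positivity.

(** * The C*-algebra of square matrices *)
Section OperatorNorm.
Variable R : realType.
Local Notation C := R[i].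
Local Notation normc := Normc.normc.
Implicit Types r s : R.

Section VectorNorm.
Variable n : nat.
Implicit Types v w : 'cV[C]_n.

Definition vnorm v : R := Num.sqrt (complex.Re (mxdot v v)).

Lemma mxdot_Re v : (complex.Re (mxdot v v))%:C%C = mxdot v v.
Proof. by apply: RRe_real; apply: ger0_real; case: (mxdot_psd C n 1). Qed.

Lemma Re_mxdot_ge0 v : 0 <= complex.Re (mxdot v v).
Proof. by rewrite -lecR mxdot_Re; case: (mxdot_psd C n 1). Qed.

Lemma vnorm_ge0 v : 0 <= vnorm v. Proof. exact: sqrtr_ge0. Qed.

Lemma vnorm_sqr v : vnorm v ^+ 2 = complex.Re (mxdot v v).
Proof. by rewrite sqr_sqrtr // Re_mxdot_ge0. Qed.

Lemma vnorm_sqrC v : (vnorm v ^+ 2)%:C%C = mxdot v v.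
Proof. by rewrite vnorm_sqr mxdot_Re. Qed.

Lemma vnorm_eq0 v : vnorm v = 0 -> v = 0.
Proof. by move=> h; apply: mxdot_definite; rewrite -vnorm_sqrC h expr0n. Qed.

Lemma vnormZ (a : C) v : vnorm (a *: v) = normc a * vnorm v.
Proof.
have na : 0 <= normc a by rewrite -lecR; apply: (@normr_ge0 _ C).
apply/eqP; rewrite -(@eqrXn2 _ 2) ?vnorm_ge0 ?mulr_ge0 ?vnorm_ge0 //.
apply/eqP/(@complexI R); rewrite exprMn [RHS]rmorphM /= !vnorm_sqrC.
rewrite (psdZl (mxdot_psd _ _ _)) (psdZr (mxdot_psd _ _ _)) mulrA; congr (_ * _).
by rewrite rmorphXn /= mulrC -normCK.
Qed.

Lemma vnorm_CS v w : normc (mxdot v w) <= vnorm v * vnorm w.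
Proof.
have nn : 0 <= normc (mxdot v w) by rewrite -lecR; apply: (@normr_ge0 _ C).
rewrite -(@ler_pXn2r _ 2) ?nnegrE ?mulr_ge0 ?vnorm_ge0 // -lecR.
rewrite exprMn [X in _ <= X]rmorphM /= !vnorm_sqrC rmorphXn /=.
exact: (psd_CS (mxdot_psd C n 1)).
Qed.

Lemma vnormD v w : vnorm (v + w) <= vnorm v + vnorm w.
Proof.
rewrite -(@ler_pXn2r _ 2) ?nnegrE ?addr_ge0 ?vnorm_ge0 //.
rewrite sqrrD !vnorm_sqr (psdDl (mxdot_psd _ _ _)) !(psdDr (mxdot_psd _ _ _)).
rewrite (psd_herm (mxdot_psd _ _ _) v w).
have ReD (x y : C) : complex.Re (x + y) = complex.Re x + complex.Re y by case: x y => [? ?] [? ?].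
rewrite !ReD.
have h : complex.Re (mxdot v w) <= vnorm v * vnorm w.
  apply: le_trans (vnorm_CS v w); case: (mxdot v w) => a b /=.
  apply: le_trans (ler_norm a) _; rewrite -sqrtr_sqr ler_wsqrtr //.
  by rewrite lerDl sqr_ge0.
have -> : complex.Re (mxdot v w)^* = complex.Re (mxdot v w) by case: (mxdot v w).
lra.
Qed.

End VectorNorm.

Lemma vnorm_sum n I (r : seq I) (P : pred I) (F : I -> 'cV[C]_n) :
  vnorm (\sum_(i <- r | P i) F i) <= \sum_(i <- r | P i) vnorm (F i).
Proof.
apply: (big_ind2 (fun v s => vnorm v <= s)) => //.
  by rewrite /vnorm (psd0r (mxdot_psd _ _ _)) sqrtr0.
by move=> v s w t hv hw; apply: le_trans (vnormD _ _) _; apply: lerD.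
Qed.

Section Op.
Variable n : nat.
Implicit Types (A B : 'M[C]_n) (v w : 'cV[C]_n).

Lemma normc_ge0 (z : C) : 0 <= normc z.
Proof. by rewrite -lecR; apply: (@normr_ge0 _ C). Qed.

Lemma vnorm_entry v i : normc (v i 0) <= vnorm v.
Proof.
rewrite -(@ler_pXn2r _ 2) ?nnegrE ?vnorm_ge0 ?normc_ge0 // -lecR vnorm_sqrC.
rewrite rmorphXn /= mxdotE big_ord1 (bigD1 i) //= -[(normc _)%:C%C]/(`|v i 0|).
rewrite normCK mulrC lerDl; apply: sumr_ge0 => j _; exact: conj_mul_ge0.
Qed.

Lemma vnorm_delta (i : 'I_n) : vnorm (delta_mx i 0) = 1.
Proof.
rewrite /vnorm mxdotE big_ord1 (bigD1 i) //= !mxE !eqxx big1 ?addr0 => [|j ji].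
  by rewrite conjC1 mulr1 /= sqrtr1.
by rewrite !mxE (negPf ji) mulr0.
Qed.

Lemma vnorm_mul_bound A v :
  vnorm (A *m v) <= (\sum_j \sum_i normc (A i j)) * vnorm v.
Proof.
have -> : A *m v = \sum_j \sum_i (A i j * v j 0) *: delta_mx i 0.
  apply/matrixP => i o; rewrite ord1 mxE summxE; apply: eq_bigr => j _.
  rewrite summxE (bigD1 i) //= !mxE !eqxx mulr1 big1 ?addr0 // => k ki.
  by rewrite !mxE eq_sym (negPf ki) mulr0.
apply: le_trans (vnorm_sum _ _ _) _; rewrite mulr_suml; apply: ler_sum => j _.
apply: le_trans (vnorm_sum _ _ _) _; rewrite mulr_suml; apply: ler_sum => i _.
rewrite vnormZ vnorm_delta mulr1 Normc.normcM.
by apply: ler_wpM2l; [exact: normc_ge0|exact: vnorm_entry].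
Qed.

Definition opnorm A : R :=
  sup (fun r => exists v, vnorm v <= 1 /\ r = vnorm (A *m v)).

Lemma opnorm_has_sup A :
  has_sup (fun r => exists v, vnorm v <= 1 /\ r = vnorm (A *m v)).
Proof.
split.
  by exists (vnorm (A *m 0)), 0; split=> //; rewrite /vnorm (psd0r (mxdot_psd _ _ _)) sqrtr0.
exists (\sum_j \sum_i normc (A i j)) => _ [v [v1 ->]].
apply: le_trans (vnorm_mul_bound A v) _; rewrite -[leRHS]mulr1.
apply: ler_wpM2l => //; do 2!apply: sumr_ge0 => ? _; exact: normc_ge0.
Qed.

Lemma opnorm_ge0 A : 0 <= opnorm A.
Proof.
have [_ ub] := opnorm_has_sup A.
apply: le_trans (vnorm_ge0 (A *m 0)) _; apply: (ub_le_sup ub).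
by exists 0; split=> //; rewrite /vnorm (psd0r (mxdot_psd _ _ _)) sqrtr0.
Qed.

Lemma opnorm_bound A v : vnorm (A *m v) <= opnorm A * vnorm v.
Proof.
have [v0|v0] := eqVneq (vnorm v) 0.
  rewrite v0 mulr0 (vnorm_eq0 v0) mulmx0 /vnorm (psd0r (mxdot_psd _ _ _)) sqrtr0.
  by [].
have vp : 0 < vnorm v by rewrite lt_def v0 vnorm_ge0.
have [_ ub] := opnorm_has_sup A.
have nV : normc ((vnorm v)^-1)%:C%C = (vnorm v)^-1.
  by rewrite /= expr0n addr0 sqrtr_sqr ger0_norm // invr_ge0 vnorm_ge0.
have : vnorm (A *m (((vnorm v)^-1)%:C%C *: v)) <= opnorm A.
  apply: (ub_le_sup ub); exists (((vnorm v)^-1)%:C%C *: v); split=> //.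
  by rewrite vnormZ nV mulVf.
by rewrite -scalemxAr vnormZ nV mulrC ler_pdivrMr.
Qed.

Lemma opnorm_le A M : 0 <= M -> (forall v, vnorm (A *m v) <= M * vnorm v) ->
  opnorm A <= M.
Proof.
move=> M0 h; apply: ge_sup; first by case: (opnorm_has_sup A).
move=> _ [v [v1 ->]]; apply: le_trans (h v) _.
by rewrite -[leRHS]mulr1; apply: ler_wpM2l.
Qed.

Lemma opnorm_eq0 A : opnorm A = 0 -> A = 0.
Proof.
move=> h; apply/matrixP => i j; have := opnorm_bound A (delta_mx j 0).
rewrite h mul0r => h0; have : vnorm (A *m delta_mx j 0) = 0.
  by apply/eqP; rewrite eq_le h0 vnorm_ge0.
by move/vnorm_eq0; rewrite -colE => /matrixP/(_ i 0); rewrite !mxE.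
Qed.

Lemma opnormD A B : opnorm (A + B) <= opnorm A + opnorm B.
Proof.
apply: opnorm_le => [|v]; first by rewrite addr_ge0 ?opnorm_ge0.
rewrite mulmxDl mulrDl; apply: le_trans (vnormD _ _) _.
by apply: lerD; apply: opnorm_bound.
Qed.

Lemma opnormZ_le (a : C) A : opnorm (a *: A) <= normc a * opnorm A.
Proof.
apply: opnorm_le => [|v]; first by rewrite mulr_ge0 ?opnorm_ge0 ?normc_ge0.
rewrite -scalemxAl vnormZ -mulrA; apply: ler_wpM2l; first exact: normc_ge0.
exact: opnorm_bound.
Qed.

Lemma opnormZ (a : C) A : opnorm (a *: A) = normc a * opnorm A.
Proof.
apply/eqP; rewrite eq_le opnormZ_le /=.
have [->|a0] := eqVneq a 0; first by rewrite Normc.normc0 mul0r opnorm_ge0.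
have na : normc a != 0 by apply: contra a0 => /eqP/Normc.eq0_normc ->.
have np : 0 < normc a by rewrite lt_def na normc_ge0.
have := opnormZ_le a^-1 (a *: A); rewrite scalerA mulVf // scale1r Normc.normcV.
by rewrite mulrC ler_pdivlMr // mulrC.
Qed.

Lemma opnormM A B : opnorm (A *m B) <= opnorm A * opnorm B.
Proof.
apply: opnorm_le => [|v]; first by rewrite mulr_ge0 ?opnorm_ge0.
rewrite -mulmxA -mulrA; apply: le_trans (opnorm_bound _ _) _.
apply: ler_wpM2l; [exact: opnorm_ge0|exact: opnorm_bound].
Qed.

(** Cauchy-Schwarz applied to the inner product of [v] and [A^*t A v]. *)
Lemma opnorm_sqr_le A : opnorm A ^+ 2 <= opnorm (A^*t *m A).
Proof.
rewrite -[leRHS]sqr_sqrtr ?opnorm_ge0 //.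
rewrite ler_pXn2r ?nnegrE ?sqrtr_ge0 ?opnorm_ge0 //.
apply: opnorm_le => [|v]; first exact: sqrtr_ge0.
rewrite -(@ler_pXn2r _ 2) ?nnegrE ?mulr_ge0 ?sqrtr_ge0 ?vnorm_ge0 //.
rewrite exprMn [X in X <= _]vnorm_sqr sqr_sqrtr ?opnorm_ge0 //.
have -> : mxdot (A *m v) (A *m v) = mxdot v (A^*t *m A *m v).
  by rewrite /mxdot conjtrM !mulmxA.
have hre (z : C) : complex.Re z <= normc z.
  case: z => a b /=; apply: le_trans (ler_norm a) _; rewrite -sqrtr_sqr ler_wsqrtr //.
  by rewrite lerDl sqr_ge0.
apply: le_trans (hre _) _; apply: le_trans (vnorm_CS _ _) _.
rewrite expr2 mulrCA; apply: ler_wpM2l; first exact: vnorm_ge0.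
exact: opnorm_bound.
Qed.

Lemma opnorm_adj_le A : opnorm A <= opnorm A^*t.
Proof.
have [->|A0] := eqVneq (opnorm A) 0; first exact: opnorm_ge0.
have Ap : 0 < opnorm A by rewrite lt_def A0 opnorm_ge0.
rewrite -(ler_pM2r Ap); apply: le_trans (opnormM _ _).
by rewrite -expr2; apply: opnorm_sqr_le.
Qed.

Lemma opnorm_Cstar A : opnorm (A^*t *m A) = opnorm A ^+ 2.
Proof.
apply/eqP; rewrite eq_le opnorm_sqr_le andbT.
apply: le_trans (opnormM _ _) _; rewrite expr2; apply: ler_wpM2r; first exact: opnorm_ge0.
by have := opnorm_adj_le A^*t; rewrite conjtrK.
Qed.

Lemma opnorm_entry A i j : normc (A i j) <= opnorm A.
Proof.
have := opnorm_bound A (delta_mx j 0); rewrite vnorm_delta mulr1.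
apply: le_trans; apply: le_trans (vnorm_entry _ i).
by rewrite -colE mxE.
Qed.

Lemma opnorm_sum_entries A : opnorm A <= \sum_j \sum_i normc (A i j).
Proof.
apply: opnorm_le; last exact: vnorm_mul_bound.
by do 2!apply: sumr_ge0 => ? _; exact: normc_ge0.
Qed.

End Op.

(** The limit is the supremum of the eventual lower bounds of the sequence. *)
Lemma real_cauchy (u : nat -> R) :
  (forall e : R, 0 < e -> exists N : nat, forall m n, (N <= m)%N -> (N <= n)%N ->
     `|u m - u n| < e) ->
  exists l, forall e : R, 0 < e -> exists N : nat, forall n, (N <= n)%N -> `|u n - l| < e.
Proof.
move=> cu; pose S : set R := fun x => exists N, forall n, (N <= n)%N -> x <= u n.
have near (e : R) : 0 < e -> exists N, forall n, (N <= n)%N ->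
    S (u n - e) /\ forall x, S x -> x <= u n + e.
  move=> e0; have [N hN] := cu e e0; exists N => n Nn; split.
    by exists N => m Nm; have := hN n m Nn Nm; rewrite ltr_norml => /andP[_]; lra.
  move=> x [M hM]; have := hM _ (leq_maxr N M).
  by have := hN (maxn N M) n (leq_maxl _ _) Nn; rewrite ltr_norml => /andP[_]; lra.
have [N1 h1] := near 1 ltr01; have [S1 U1] := h1 _ (leqnn _).
have ubS : has_ubound S by exists (u N1 + 1).
have Sne : (S !=set0)%classic by exists (u N1 - 1).
exists (sup S) => e e0.
have e2 : 0 < e / 2 by rewrite divr_gt0.
have [N hN] := near _ e2; exists N => n Nn; have [Sn Un] := hN _ Nn.
have lS : u n - e / 2 <= sup S by apply: ub_le_sup.
have uS : sup S <= u n + e / 2 by apply: ge_sup.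
by rewrite ltr_norml; apply/andP; split; lra.
Qed.

Lemma complex_cauchy (u : nat -> C) :
  (forall e : R, 0 < e -> exists N : nat, forall m n, (N <= m)%N -> (N <= n)%N ->
     normc (u m - u n) < e) ->
  exists l, forall e : R, 0 < e -> exists N : nat, forall n, (N <= n)%N ->
     normc (u n - l) < e.
Proof.
move=> cu.
have ReB (x y : C) : complex.Re (x - y) = complex.Re x - complex.Re y.
  by case: x y => [? ?] [? ?].
have ImB (x y : C) : complex.Im (x - y) = complex.Im x - complex.Im y.
  by case: x y => [? ?] [? ?].
have Rele (x : C) : `|complex.Re x| <= normc x.
  by case: x => a b /=; rewrite -sqrtr_sqr ler_wsqrtr // lerDl sqr_ge0.
have Imle (x : C) : `|complex.Im x| <= normc x.
  by case: x => a b /=; rewrite -sqrtr_sqr ler_wsqrtr // lerDr sqr_ge0.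
have lenorm (x : C) : normc x <= `|complex.Re x| + `|complex.Im x|.
  case: x => a b /=; rewrite -(@ler_pXn2r _ 2) ?nnegrE ?addr_ge0 ?sqrtr_ge0 //.
  rewrite sqr_sqrtr ?addr_ge0 ?sqr_ge0 // sqrrD !real_normK ?num_real //.
  rewrite addrAC lerDl mulrn_wge0 // mulr_ge0 //.
have [|a ha] := @real_cauchy (fun n => complex.Re (u n)).
  move=> e /cu [N hN]; exists N => m n Nm Nn.
  by rewrite -ReB; apply: le_lt_trans (Rele _) (hN _ _ Nm Nn).
have [|b hb] := @real_cauchy (fun n => complex.Im (u n)).
  move=> e /cu [N hN]; exists N => m n Nm Nn.
  by rewrite -ImB; apply: le_lt_trans (Imle _) (hN _ _ Nm Nn).
exists (a +i* b)%C => e e0; have e2 : 0 < e / 2 by rewrite divr_gt0.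
have [N hN] := ha _ e2; have [M hM] := hb _ e2.
exists (maxn N M) => n; rewrite geq_max => /andP[/hN h1 /hM h2].
apply: le_lt_trans (lenorm _) _; rewrite ReB ImB /=; lra.
Qed.

Lemma opnorm_complete n (u : nat -> 'M[C]_n) :
  (forall e : R, 0 < e -> exists N : nat, forall m k, (N <= m)%N -> (N <= k)%N ->
     opnorm (u m - u k) < e) ->
  exists l, forall e : R, 0 < e -> exists N : nat, forall k, (N <= k)%N ->
     opnorm (u k - l) < e.
Proof.
move=> cu.
have ex (p : 'I_n * 'I_n) : exists l : C, forall e : R, 0 < e -> exists N : nat,
    forall k, (N <= k)%N -> normc (u k p.1 p.2 - l) < e.
  apply: complex_cauchy => e /cu [N hN]; exists N => m k Nm Nk.
  apply: le_lt_trans (hN _ _ Nm Nk).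
  by have := opnorm_entry (u m - u k) p.1 p.2; rewrite !mxE.
have [l hl] := choice ex; exists (\matrix_(i, j) l (i, j)) => e e0.
(* the successor covers [n = 0] *)
pose d : R := e / (n * n).+1%:R.
have d0 : 0 < d by rewrite divr_gt0.
have [N hN] := choice (fun p => hl p d d0).
exists (\max_p N p) => k Nk; apply: le_lt_trans (opnorm_sum_entries _) _.
apply: (@le_lt_trans _ _ (\sum_(j < n) \sum_(i < n) d)).
  apply: ler_sum => j _; apply: ler_sum => i _; rewrite !mxE.
  apply/ltW/(hN (i, j)); apply: leq_trans Nk; exact: leq_bigmax.
rewrite !sumr_const !card_ord -mulrnA -mulr_natr /d mulrAC ltr_pdivrMr ?ltr0n //.
by rewrite ltr_pM2l // ltr_nat.
Qed.

Lemma conjtr_star n : is_star (fun A : 'M[C]_n.+1 => A^*t).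
Proof.
split=> [A|A B|a A|A B]; first exact: conjtrK.
- by rewrite linearD /= map_mxD.
- by rewrite linearZ /= map_mxZ.
- exact: conjtrM.
Qed.

Definition matrix_Cstar n : fdCstarAlg R :=
  @FdCstarAlg R 'M[C]_n.+1 (fun A => A^*t) (@opnorm n.+1) (conjtr_star n)
    (@opnorm_ge0 n.+1) (@opnorm_eq0 n.+1) (@opnormD n.+1) (@opnormZ n.+1)
    (@opnormM n.+1) (@opnorm_Cstar n.+1) (@opnorm_complete n.+1).

End OperatorNorm.

(** * The trace of the regular representation *)
Section Trace.
Variable C : numClosedFieldType.

(** The trace is the sum of the roots of the characteristic polynomial. If it
vanishes all eigenvalues do, and the matrix is nilpotent by Cayley-Hamilton. *)
Lemma trace_nonneg_eigenvalues n (T : 'M[C]_n) :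
  (forall a, eigenvalue T a -> 0 <= a) ->
  0 <= \tr T /\ (\tr T = 0 -> exists m, iter m (mulmx T) 1%:M = 0).
Proof.
case: n T => [|n] T h.
  by split; [rewrite /mxtrace big_ord0|exists 0%N; apply: flatmx0].
have [r rE] := closed_field_poly_normal (char_poly T).
rewrite (monicP (char_poly_monic T)) scale1r in rE.
have rn : size r = n.+1.
  by have := size_char_poly T; rewrite rE size_prod_XsubC => -[].
have r0 a : a \in r -> 0 <= a.
  by move=> ar; apply: h; rewrite eigenvalue_root_char rE root_prod_XsubC.
have trE : \tr T = \sum_(a <- r) a.
  by apply: oppr_inj; rewrite -char_poly_trace // rE -coefPn_prod_XsubC ?rn.
rewrite trE; split; first by rewrite big_seq; apply: sumr_ge0 => a /r0.
move=> /eqP; rewrite big_seq psumr_eq0; last by move=> a /r0.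
move=> /allP r00; exists n.+1.
have iterE m : iter m (mulmx T) 1%:M = T ^+ m by elim: m => //= m ->; rewrite exprS.
have rz : r = nseq n.+1 0.
  rewrite -rn; apply/all_pred1P/allP => a ar.
  by have /implyP := r00 a ar; apply.
have := Cayley_Hamilton T; rewrite rE rz big_nseq iter_mulr_1 subr0.
by rewrite rmorphXn /= horner_mx_X iterE exprS.
Qed.
End Trace.

Section LeftMultiplication.
Variables (R : realType) (B : fdCstarAlg R).
Local Notation C := R[i].
Let e := vbasis (fullv : {vspace B}).

Definition left_mult_mx (b : B) : 'M[C]_(\dim (fullv : {vspace B})) :=
  passmx.mxof e e (amull b).

Let eb : basis_of fullv e. Proof. exact: vbasisP. Qed.

Lemma mul_left_mult (b x : B) :
  passmx.rVof e x *m left_mult_mx b = passmx.rVof e (b * x).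
Proof. by rewrite /left_mult_mx -(passmx.rVof_app _ eb) lfunE. Qed.

Lemma basis_coordZ a (x : B) : passmx.rVof e (a *: x) = a *: passmx.rVof e x.
Proof. by apply/rowP => i; rewrite !mxE linearZ. Qed.

Lemma left_mult_linear : linear left_mult_mx.
Proof. by move=> a b c; rewrite /left_mult_mx amull_is_linear passmx.mxof_linear. Qed.

Lemma left_mult_mul (b c : B) : left_mult_mx (b * c) = left_mult_mx c *m left_mult_mx b.
Proof.
apply/row_matrixP => i; rewrite !rowE mulmxA.
have -> : delta_mx 0 i = passmx.rVof e (passmx.vecof e (delta_mx 0 i)).
  by rewrite (passmx.vecofK eb).
by rewrite !mul_left_mult mulrA.
Qed.

Definition reg_trace (b : B) : C := \tr (left_mult_mx b).

Lemma reg_trace_scalar : scalar reg_trace.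
Proof. by move=> a b c; rewrite /reg_trace left_mult_linear linearP. Qed.

Lemma reg_trace0 : reg_trace 0 = 0.
Proof.
have := reg_trace_scalar (-1) 0 0.
by rewrite scaler0 addr0 mulN1r addNr.
Qed.

Local Notation st := (@fdc_star R B).

(** Positivity in [B] is derived below from this properness of the involution. *)
Lemma fdc_proper (x : B) : st x * x = 0 -> x = 0.
Proof.
move=> h; apply: fdc_norm_eq0; have := fdc_Cstar x; rewrite h.
have -> : fdc_norm (0 : B) = 0.
  by rewrite -(scale0r (0 : B)) fdc_normZ Normc.normc0 mul0r.
by move=> /esym/eqP; rewrite sqrf_eq0 => /eqP.
Qed.

(** When [b] is normal, left multiplication by [b] preserves the eigenspace, so
there is a common eigenvector [x], say with [b x = m x]. Then the two
expressions of [star x * star b * b * x] give [a = m^* m]. *)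
Lemma left_mult_eigen_ge0 (b : B) (a : C) : st b * b = b * st b ->
  eigenvalue (left_mult_mx (st b * b)) a -> 0 <= a.
Proof.
move=> bn; set T := left_mult_mx _ => ea.
have [_ sD sZ sM] := fdc_starP B.
pose W := row_base (eigenspace T a); pose M := left_mult_mx b.
have WT : W *m T = a *: W by apply/eigenspaceP; rewrite eq_row_base.
have TM : T *m M = M *m T.
  by rewrite /T /M -!left_mult_mul mulrA -bn.
have WM : (W *m M <= W)%MS.
  rewrite {2}/W eq_row_base; apply/eigenspaceP.
  by rewrite -mulmxA -TM mulmxA WT -scalemxAl.
have rk : (0 < \rank (eigenspace T a))%N by rewrite lt0n mxrank_eq0.
have [m] := eigenvalue_closed (W *m M *m pinvmx W) rk.
move=> /eigenvalueP [v vX v0].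
pose x := passmx.vecof e (v *m W).
have xv : passmx.rVof e x = v *m W by rewrite (passmx.vecofK eb).
have x0 : x <> 0.
  move=> /eqP; rewrite -(passmx.rVof_eq0 eb) xv.
  by rewrite mulmx_free_eq0 ?row_base_free // (negPf v0).
have inj y z : passmx.rVof e y = passmx.rVof e z -> y = z.
  by move=> h; rewrite -[y](passmx.rVofK eb) h (passmx.rVofK eb).
have bx : b * x = m *: x.
  apply: inj; rewrite -mul_left_mult basis_coordZ xv -/M -mulmxA.
  by rewrite -(mulmxKpV WM) [v *m (_ *m _)]mulmxA vX -scalemxAl.
have cx : st b * b * x = a *: x.
  by apply: inj; rewrite -mul_left_mult basis_coordZ xv -mulmxA WT -scalemxAr.
have : (m^* * m) *: (st x * x) = a *: (st x * x).
  rewrite [RHS]scalerAr -cx -mulrA [RHS]mulrA -sM bx sZ -scalerAl -scalerAr.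
  by rewrite scalerA.
move=> /eqP; rewrite -subr_eq0 -scalerBl scaler_eq0 subr_eq0 => /orP [/eqP <-|/eqP].
  exact: conj_mul_ge0.
by move/fdc_proper.
Qed.

(** If the trace vanishes then [c = star b * b] is nilpotent; a selfadjoint
nilpotent element [c] is zero, as the last nonzero power of [c] has zero square. *)
Lemma reg_trace_ge0 (b : B) : st b * b = b * st b ->
  0 <= reg_trace (st b * b) /\ (reg_trace (st b * b) = 0 -> b = 0).
Proof.
move=> bn; have [sK sD sZ sM] := fdc_starP B.
have [h1 h2] := trace_nonneg_eigenvalues (fun a => left_mult_eigen_ge0 bn).
split=> // /h2 [m hm]; apply: fdc_proper.
set c := st b * b in hm *.
have cs : st c = c by rewrite /c sM sK.
have cm : c ^+ m = 0.
  have it k : iter k (mulmx (left_mult_mx c)) 1%:M = left_mult_mx (c ^+ k).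
    elim: k => [|k ih] /=.
      apply/row_matrixP => i; rewrite !rowE mulmx1.
      have -> : delta_mx 0 i = passmx.rVof e (passmx.vecof e (delta_mx 0 i)).
        by rewrite (passmx.vecofK eb).
      by rewrite mul_left_mult mul1r.
    by rewrite ih exprSr left_mult_mul.
  have : passmx.rVof e (c ^+ m) = 0.
    by rewrite -[c ^+ m]mulr1 -mul_left_mult -it hm mulmx0.
  by move=> /eqP; rewrite (passmx.rVof_eq0 eb) => /eqP.
have {hm} [k ck kmin] := ex_minnP (ex_intro (fun k => c ^+ k == 0) m (introT eqP cm)).
have sX l : st (c ^+ l) = c ^+ l.
  elim: l => [|l ih]; last by rewrite [in LHS]exprS sM ih cs -exprSr.
  by rewrite expr0 -[RHS]sK -[st 1 in RHS]mulr1 sM sK mulr1.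
case: k ck kmin => [|[|k]] ck kmin.
- by move: ck; rewrite expr0 oner_eq0.
- by move: ck; rewrite expr1 => /eqP.
have : c ^+ k.+1 = 0.
  apply: fdc_proper; rewrite sX -exprD addSnnS exprD (eqP ck) ?mulr0 //.
by move=> /eqP /kmin; rewrite ltnn.
Qed.

End LeftMultiplication.

(** * The induced representation *)
(** The preimages of a free family of maximal size in the range of [f]. *)
Lemma finite_image_span (K : fieldType) (V : lmodType K) (W : vectType K)
    (f : {linear V -> W}) :
  exists m (s : 'I_m -> V), forall a, exists c : 'I_m -> K,
    f (a - \sum_i c i *: s i) = 0.
Proof.
pose Q m := `[< exists s : m.-tuple V, free (map f s) >].
have exQ : exists m, Q m by exists 0%N; apply/asboolP; exists [tuple]; apply: nil_free.
have QM m : Q m -> (m <= \dim {:W})%N.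
  move=> /asboolP [s]; rewrite /free size_map size_tuple => /eqP <-.
  by apply: dimvS; apply: subvf.
have [m /asboolP [s fs] mmax] := ex_maxnP exQ QM.
exists m, (tnth s) => a.
have fa : f a \in <<map f s>>%VS.
  apply: contraT => na; suff /mmax : Q m.+1 by rewrite ltnn.
  by apply/asboolP; exists [tuple of a :: s]; rewrite /= free_cons na.
exists (fun i => coord (map_tuple f s) i (f a)).
apply/eqP; rewrite linearB subr_eq0; apply/eqP.
rewrite {1}(coord_span fa) linear_sum; apply: eq_bigr => i _.
by rewrite linearZ /= (nth_map 0) ?size_tuple // -tnth_nth.
Qed.

Section GNS.
Variables (R : realType) (H : hopfStarAlg R).
Local Notation C := R[i].
Variables (phi : {scalar H}).
Hypothesis phi_ge0 : forall x, 0 <= phi (star x * x).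

(** The GNS form; it is degenerate in general. *)
Definition gns x y : C := phi (star x * y).

Lemma gns_psd : psd_form gns.
Proof.
split=> [x a y z|a x y z|x]; last exact: phi_ge0.
- by rewrite /gns mulrDr -scalerAr linearD linearZ.
- by rewrite /gns starD starZ mulrDl -scalerAl linearD linearZ.
Qed.

Lemma gns_adj x y z : gns y (x * z) = gns (star x * y) z.
Proof. by rewrite /gns starM star_invol mulrA. Qed.

Hypothesis phi1 : phi 1 != 0.
Hypothesis gns_fin : exists M (g : 'I_M -> H), forall x, exists c : 'I_M -> C,
  forall y, gns y x = gns y (\sum_i c i *: g i).

Lemma gns_orthonormal_bound M (g : 'I_M -> H) k (e : 'I_k -> H) :
  (forall x, exists c : 'I_M -> C, forall y, gns y x = gns y (\sum_i c i *: g i)) ->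
  orthonormal_family gns e -> (k <= M)%N.
Proof.
move=> gP oe; have [c cP] := choice (fun j => gP (e j)).
pose P := \matrix_(i < k, t < M) gns (e i) (g t).
pose Q := \matrix_(t < M, j < k) c j t.
have PQ : P *m Q = 1%:M.
  apply/matrixP => i j; rewrite !mxE -oe cP (psd_sumr gns_psd).
  by apply: eq_bigr => t _; rewrite !mxE (psdZr gns_psd) mulrC.
by rewrite -(mxrank1 C k) -PQ (leq_trans (mxrankM_maxl _ _)) // rank_leq_col.
Qed.

(** Matrix entries of the left regular action in an orthonormal family spanning
[H] modulo null vectors. *)
Lemma gns_representation : exists n (rho : {lrmorphism H -> 'M[C]_n.+1}),
  (forall x, rho (star x) = (rho x)^*t) /\ forall x, rho x = 0 -> phi x = 0.
Proof.
have [M [g gP]] := gns_fin.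
have sT : @subspace C H setT by [].
have [k e _ oe|k [e [_ oe eP]]] := @maximal_orthonormal _ _ _ gns_psd setT M sT.
  exact: gns_orthonormal_bound oe.
have expand y x : gns y x = \sum_i gns (e i) x * gns y (e i).
  have r0 := eP x I; apply/eqP; rewrite -subr_eq0; apply/eqP.
  transitivity (gns y (x - \sum_i gns (e i) x *: e i)).
    rewrite (psdBr gns_psd) (psd_sumr gns_psd); congr (_ - _).
    by apply: eq_bigr => i _; rewrite (psdZr gns_psd).
  by rewrite (psd_herm gns_psd (x - \sum_i gns (e i) x *: e i) y) (psd_null gns_psd) ?conjC0.
(* an empty family would make every vector null, against [phi 1 != 0] *)
case: k e oe eP expand => [|k] e oe eP expand.
  have := expand 1 1; rewrite big_ord0 /gns star1 mulr1 => p1.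
  by move: phi1; rewrite p1 eqxx.
pose rho x : 'M[C]_k.+1 := \matrix_(i, j) gns (e i) (x * e j).
have rho_lin : linear rho.
  move=> a x y; apply/matrixP => i j; rewrite !mxE mulrDl -scalerAl.
  by rewrite (psdDr gns_psd) (psdZr gns_psd).
have rho_mul : monoid_morphism rho.
  split; first by apply/matrixP => i j; rewrite !mxE mul1r oe.
  move=> x y; apply/matrixP => i j; rewrite !mxE -mulrA gns_adj expand.
  by apply: eq_bigr => l _; rewrite !mxE mulrC -gns_adj.
pose rho' : {lrmorphism H -> 'M[C]_k.+1} := HB.pack rho
  (GRing.isLinear.Build C H 'M[C]_k.+1 _ rho rho_lin)
  (GRing.isMonoidMorphism.Build H 'M[C]_k.+1 rho rho_mul).
exists k, rho'; split=> [x|x rx].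
  apply/matrixP => i j; rewrite !mxE gns_adj star_invol.
  exact: (psd_herm gns_psd).
have rx0 i j : gns (e i) (x * e j) = 0.
  by have /matrixP/(_ i j) := rx; rewrite !mxE.
have h i : gns (e i) x = 0.
  rewrite -[x]mulr1 gns_adj expand big1 // => j _.
  by rewrite -gns_adj rx0 mulr0.
by have := expand 1 x; rewrite /gns star1 mul1r => ->; rewrite big1 // => i _; rewrite [phi _]h mul0r.
Qed.

End GNS.

Section Induction.
Variables (R : realType) (H : hopfStarAlg R) (A : hopfStarSubalg H).
Local Notation C := R[i].
Local Notation iA := (incl A).
Hypothesis Hc : compact_hopf H.
Local Notation E := (@expectation R H A Hc).
Variables (B : fdCstarAlg R) (pi : {lrmorphism A -> B}).
Hypothesis pi_star : forall x, pi (star x) = fdc_star (pi x).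
Hypothesis Acomm : commutative_alg A.

(** The trace detects the kernel of [pi]; the counit is added so that the vanishing
of [theta] on an ideal also forces the counit to vanish there. *)
Definition theta (a : A) : C := reg_trace (pi a) + eps a.

Lemma theta_scalar : scalar theta.
Proof.
move=> a x y; rewrite /theta linearP reg_trace_scalar linearP /=.
by rewrite mulrDr addrACA.
Qed.
HB.instance Definition _ := GRing.isLinear.Build C A C _ theta theta_scalar.

Lemma eps_incl (a : A) : eps (iA a) = eps a.
Proof. exact: incl_counit. Qed.

Lemma theta_positive (z : A) : 0 <= theta (star z * z) /\
  (theta (star z * z) = 0 -> pi z = 0 /\ eps z = 0).
Proof.
have ez : eps (star z * z) = (eps z)^* * eps z.
  by rewrite rmorphM /= -eps_incl -incl_star eps_star // eps_incl.
have [|t0 tz] := @reg_trace_ge0 _ B (pi z).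
  by rewrite -pi_star -!rmorphM Acomm.
rewrite /theta ez rmorphM /= pi_star; split; first by rewrite addr_ge0 ?conj_mul_ge0.
move=> /eqP; rewrite paddr_eq0 ?conj_mul_ge0 // => /andP [/eqP/tz -> /eqP /eqP].
by rewrite mulf_eq0 conjC_eq0 orbb => /eqP.
Qed.

Definition induced (x : H) : C := theta (E x).
Lemma induced_scalar : scalar induced.
Proof. by move=> a x y; rewrite /induced !linearP. Qed.
HB.instance Definition _ := GRing.isLinear.Build C H C _ induced induced_scalar.

Lemma induced_ge0 x : 0 <= induced (star x * x).
Proof.
rewrite /induced; have [m [z ->]] := expectation_positive A Hc x.
by rewrite linear_sum; apply: sumr_ge0 => i _; case: (theta_positive (z i)).
Qed.

Lemma induced1 : induced 1 != 0.
Proof.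
rewrite /induced -(rmorph1 iA) expectation_incl; apply/eqP => t1.
have [_ h] := theta_positive 1.
have [|_ e1] := h; first by rewrite mulr1 star1.
by have := oner_neq0 C; rewrite -e1 rmorph1 eqxx.
Qed.

(** Modulo null vectors, the coefficients in [A] of a generator only matter through
their images by [pi] and the counit, which lie in a finite-dimensional space. *)
Lemma induced_fin : fg_right_module A -> exists M (g : 'I_M -> H), forall x,
  exists c : 'I_M -> C,
  forall y, gns induced y x = gns induced y (\sum_i c i *: g i).
Proof.
move=> [n [h hP]].
pose f (a : A) : (B * C^o)%type := (pi a, eps a).
have f_lin : linear f by move=> a x y; rewrite /f !linearP.
pose f' : {linear A -> (B * C^o)%type} := HB.pack f (GRing.isLinear.Build C A (B * C^o)%type _ f f_lin).
have [m [s sP]] := finite_image_span f'.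
exists #|{: 'I_n * 'I_m}|, (fun i => h (enum_val i).1 * iA (s (enum_val i).2)) => x.
have [a aE] := hP x; have [c cP] := choice (fun i => sP (a i)).
exists (fun i => c (enum_val i).1 (enum_val i).2) => y.
rewrite -(sum_enum_val (fun p => c p.1 p.2 *: (h p.1 * iA (s p.2)))) sum_pair aE.
rewrite !(psd_sumr (gns_psd induced_ge0)); apply: eq_bigr => i _.
have -> : \sum_j c (i, j).1 (i, j).2 *: (h (i, j).1 * iA (s (i, j).2)) = h i * iA (\sum_j c i j *: s j).
  rewrite linear_sum mulr_sumr; apply: eq_bigr => j _.
  by rewrite linearZ /= scalerAr.
apply/eqP; rewrite -subr_eq0 -(psdBr (gns_psd induced_ge0)) -mulrBr -linearB /=.
set k := _ - _; have [pk ek] : pi k = 0 /\ eps k = 0 by have [] := cP i.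
rewrite /gns mulrA /induced expectation_mulr /theta !rmorphM /= pk ek !mulr0 addr0.
by rewrite reg_trace0.
Qed.

End Induction.

(** * The theorem *)

Theorem theorem5p7 (R : realType) (H : hopfStarAlg R) (A : hopfStarSubalg H) :
  compact_hopf H ->
  normal_subalg A ->
  inner_unitary A ->
  commutative_alg A ->
  fg_right_module A ->
  inner_unitary H.
Proof.
move=> Hc _ [B [pi [pi_star pi_inner]]] Acomm Afg.
pose E := @expectation R H A Hc.
have [n [rho [rho_star rho0]]] := gns_representation
  (induced_ge0 Hc pi_star Acomm) (induced1 Hc pi_star Acomm)
  (induced_fin Hc pi_star Acomm Afg).
exists (matrix_Cstar R n), (rho : {lrmorphism H -> matrix_Cstar R n}); split=> //.
move=> [I [[[I0 ID IL IR] Icomul Icounit Iant Istar] In0 Ker]].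
(* the image of [I] under the expectation *)
pose J : set A := fun a => exists2 x, I x & a = E x.
have Jtheta a : J a -> theta pi a = 0.
  by move=> [x Ix ->]; apply: (rho0 x); apply: Ker.
have JL a b : J b -> J (a * b).
  by move=> [x Ix ->]; exists (incl A a * x); [apply: IL|rewrite /E expectation_mull].
have JR a b : J b -> J (b * a).
  by move=> [x Ix ->]; exists (x * incl A a); [apply: IR|rewrite /E expectation_mulr].
have Jnull a : J a -> pi a = 0 /\ eps a = 0.
  move=> Ja; have [_ h] := theta_positive Hc pi_star Acomm a.
  by apply: h; apply/Jtheta/JL.
have J0 : J = [set 0]%classic.
  apply: contrapT => Jn0; apply: pi_inner; exists J; split=> //; last first.
    by move=> a /Jnull [].
  split.
  - split=> //; first by exists 0 => //; rewrite /E linear0.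
    by move=> _ _ [x Ix ->] [y Iy ->]; exists (x + y); [apply: ID|rewrite /E linearD].
  - move=> _ [x Ix ->]; have [t [u [[s [sI ->]] [s' [s'I ->]] xE]]] := Icomul x Ix.
    exists (tmap E E (\sum_(p <- s) tens p.1 p.2)), (tmap E E (\sum_(p <- s') tens p.1 p.2)).
    split.
    + exists [seq (E p.1, E p.2) | p <- s]; split.
        by move=> _ /mapP [p ps ->] /=; split=> //; exists p.1 => //; case: (sI p ps).
      by rewrite big_map linear_sum; apply: eq_bigr => p _; apply: tmap_tens.
    + exists [seq (E p.1, E p.2) | p <- s']; split.
        by move=> _ /mapP [p ps ->] /=; split=> //; exists p.2 => //; case: (s'I p ps).
      by rewrite big_map linear_sum; apply: eq_bigr => p _; apply: tmap_tens.
    + by rewrite /E comul_expectation xE linearD.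
  - by move=> a /Jnull [].
  - by move=> _ [x Ix ->]; exists (antipode x); [apply: Iant|rewrite /E expectation_antipode].
  - by move=> _ [x Ix ->]; exists (star x); [apply: Istar|rewrite /E expectation_star].
apply: In0; apply/seteqP; split=> [x Ix|_ ->] //=.
apply: (expectation_nondegenerate (A := A) (Hc := Hc)) => y.
have : J (E (y * x)) by exists (y * x) => //; apply: IL.
by rewrite J0.
Qed.
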